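(* Let $\mathcal{F}(\mathcal{X})$ be the germ at $0\in\mathbb{C}^3$ of the holomorphic foliation defined by a vector field $\mathcal{X}\in\mathrm{Gen}\left(\mathfrak{X}(\mathbb{C}^3,0)\right)$. If $\mathcal{F}(\mathcal{X})$ possesses a formal first integral, then it also possesses a holomorphic first integral.
   Context: $\mathfrak{X}(\mathbb{C}^3,0)$ is the set of germs at $0$ of holomorphic vector fields on $\mathbb{C}^3$ vanishing at $0$; $\mathcal{F}(\mathcal{X})$ is the germ of one-dimensional singular holomorphic foliation whose leaves are the orbits of $\mathcal{X}$. $\mathcal{O}_3$ is the ring of germs of holomorphic functions at $0\in\mathbb{C}^3$, $\mathcal{M}_3$ its maximal ideal, and $\hat{\mathcal{O}}_3$ the ring of formal power series in three variables. $\mathcal{X}\in\mathrm{Gen}(\mathfrak{X}(\mathbb{C}^3,0))$ (non-degenerate generic) means that $\mathrm{d}\mathcal{X}(0)$ is non-singular and diagonalizable and that, after a suitable holomorphic change of coordinates, $\mathcal{X}$ leaves the coordinate planes invariant; after such a change of coordinates it can be written as $\mathcal{X}(x)=\sum_{i=1}^3\lambda_i x_i(1+a_i(x))\frac{\partial}{\partial x_i}$ with $\lambda_i\in\mathbb{C}^*$ and $a_i\in\mathcal{M}_3$. A formal first integral of $\mathcal{F}(\mathcal{X})$ is a formal map $\hat F=(\hat f_1,\hat f_2)$ with $\hat f_1,\hat f_2\in\hat{\mathcal{O}}_3$ such that the formal 2-form $\mathrm{d}\hat f_1\wedge\mathrm{d}\hat f_2$ is not identically zero and $\mathcal{X}(\hat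 f_1)\equiv\mathcal{X}(\hat f_2)\equiv 0$. A holomorphic first integral of $\mathcal{F}(\mathcal{X})$ is a germ of holomorphic map $F=(f_1,f_2):(\mathbb{C}^3,0)\to(\mathbb{C}^2,0)$ such that $\mathrm{d}f_1\wedge\mathrm{d}f_2$ is not identically zero and the leaves of $\mathcal{F}(\mathcal{X})$ are contained in level sets of $F$ (equivalently $\mathcal{X}(f_1)\equiv\mathcal{X}(f_2)\equiv0$). *)

(* Defs.v *)
(* MathComp-Analysis world; the complex numbers are R[i] for R : realType. *)
From HB Require Import structures.
From mathcomp Require Import all_boot all_order all_algebra.
From mathcomp Require Import all_classical all_reals all_analysis.
From mathcomp Require Export complex.
Set Implicit Arguments.
Unset Strict Implicit.
Unset Printing Implicit Defensive.
Import Order.TTheory GRing.Theory Num.Theory.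
Import numFieldNormedType.Exports.
Local Open Scope classical_set_scope.
Local Open Scope ring_scope.

(* Everything below is instantiated at K := R[i].  The base field is kept
   abstract because [complex R] itself carries no canonical topology, whereas
   every numFieldType K has the one given by its norm.  A germ at the origin
   is given by a representative K^3 -> K (or K^3 -> K^n), and every notion
   below depends on its values near 0 only. *)
Section Germs.
Variable K : numFieldType.

(* Multi-exponents, and formal power series in three variables, given by
   their coefficients. *)
Definition mon3 := {ffun 'I_3 -> nat}.
Definition fps3 := mon3 -> K.

Definition fps3_mul (a b : fps3) : fps3 := fun m =>
  \sum_(k : {dffun forall i : 'I_3, 'I_(m i).+1})
    a [ffun i => k i : nat] * b [ffun i => (m i - k i)%N].

Definition fps3_deriv (i : 'I_3) (a : fps3) : fps3 := fun m =>
  (m i).+1%:R * a [ffun j => (m j + (j == i))%N].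

(* The terms of exponents in {0, ..., N-1}^3 of the series of coefficients a
   at x, summed after applying w (either the identity or the norm). *)
Definition box_sum (w : K -> K) (a : fps3) (x : 'rV[K]_3) (N : nat) : K :=
  \sum_(k : {ffun 'I_3 -> 'I_N})
    w (a [ffun i => k i : nat] * \prod_(i < 3) x 0 i ^+ k i).

(* The power series a converges absolutely at x, with sum l. *)
Definition fps3_sums_to (a : fps3) (x : 'rV[K]_3) (l : K) : Prop :=
  (exists M : K, forall N, box_sum Num.norm a x N <= M) /\
  box_sum id a x @ \oo --> l.

(* a is the Taylor series at 0 of the germ f: its sum near 0 is f. *)
Definition taylor_at0 (f : 'rV[K]_3 -> K) (a : fps3) : Prop :=
  \forall x \near (0 : 'rV[K]_3), fps3_sums_to a x (f x).

(* Holomorphic in several variables means locally the sum of a convergent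
   power series; for a germ at 0, an expansion at 0 is enough. *)
Definition holo_at0 (f : 'rV[K]_3 -> K) : Prop := exists a, taylor_at0 f a.

Definition holo_map_at0 (n : nat) (F : 'rV[K]_3 -> 'rV[K]_n) : Prop :=
  forall i, holo_at0 (fun x => F x 0 i).

Definition vector_field_at0 (X : 'rV[K]_3 -> 'rV[K]_3) : Prop :=
  holo_map_at0 X /\ X 0 = 0.

Definition change_of_coords (Phi : 'rV[K]_3 -> 'rV[K]_3) : Prop :=
  [/\ holo_map_at0 Phi, Phi 0 = 0 &
   exists Psi : 'rV[K]_3 -> 'rV[K]_3,
     [/\ holo_map_at0 Psi, Psi 0 = 0,
      \forall x \near (0 : 'rV[K]_3), Psi (Phi x) = x &
      \forall y \near (0 : 'rV[K]_3), Phi (Psi y) = y]].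

(* Y is the expression of X in the coordinates y = Phi x. *)
Definition pushes_to (Phi X Y : 'rV[K]_3 -> 'rV[K]_3) : Prop :=
  \forall x \near (0 : 'rV[K]_3), 'd Phi x (X x) = Y (Phi x).

Definition coord_planes_invariant (Y : 'rV[K]_3 -> 'rV[K]_3) : Prop :=
  forall i : 'I_3,
    \forall y \near (0 : 'rV[K]_3), (y : 'rV[K]_3) 0 i = 0 -> Y y 0 i = 0.

(* The Jacobian matrix of the library is the transpose of the usual one,
   which affects neither invertibility nor diagonalizability. *)
Definition gen_vector_field (X : 'rV[K]_3 -> 'rV[K]_3) : Prop :=
  [/\ vector_field_at0 X,
      'J X 0 \in unitmx,
      diagonalizable ('J X 0) &
      exists Phi Y : 'rV[K]_3 -> 'rV[K]_3,
        [/\ change_of_coords Phi, vector_field_at0 Y,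
            pushes_to Phi X Y & coord_planes_invariant Y]].

(* The derivation X(f) of the formal series f, where A i is the Taylor series
   of the i-th component of X. *)
Definition fps3_lie (A : 'I_3 -> fps3) (f : fps3) : fps3 := fun m =>
  \sum_(i < 3) fps3_mul (A i) (fps3_deriv i f) m.

(* The coefficient of dx_i /\ dx_j in df1 /\ df2. *)
Definition fps3_wedge (f1 f2 : fps3) (i j : 'I_3) : fps3 := fun m =>
  fps3_mul (fps3_deriv i f1) (fps3_deriv j f2) m
  - fps3_mul (fps3_deriv j f1) (fps3_deriv i f2) m.

Definition formal_first_integral
    (X : 'rV[K]_3 -> 'rV[K]_3) (f1 f2 : fps3) : Prop :=
  ~ (forall i j m, fps3_wedge f1 f2 i j m = 0) /\
  exists A : 'I_3 -> fps3,
    [/\ forall i, taylor_at0 (fun x => X x 0 i) (A i),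
        forall m, fps3_lie A f1 m = 0 &
        forall m, fps3_lie A f2 m = 0].

(* The value of df1 /\ df2 at the point x on the pair of vectors (u, v). *)
Definition wedge_d (f1 f2 : 'rV[K]_3 -> K^o) (x u v : 'rV[K]_3) : K :=
  'd f1 x u * 'd f2 x v - 'd f1 x v * 'd f2 x u.

Definition holo_first_integral
    (X : 'rV[K]_3 -> 'rV[K]_3) (f1 f2 : 'rV[K]_3 -> K^o) : Prop :=
  [/\ holo_at0 f1 /\ holo_at0 f2,
      f1 0 = 0 /\ f2 0 = 0,
      ~ (\forall x \near (0 : 'rV[K]_3), forall u v, wedge_d f1 f2 x u v = 0),
      \forall x \near (0 : 'rV[K]_3), 'd f1 x (X x) = 0 &
      \forall x \near (0 : 'rV[K]_3), 'd f2 x (X x) = 0].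

End Germs.

(* Main.v *)
Require Import Defs.
From HB Require Import structures.
From mathcomp Require Import all_boot all_order all_algebra.
From mathcomp Require Import all_classical all_reals all_analysis.
From mathcomp Require Import zify ring.
Set Implicit Arguments.
Unset Strict Implicit.
Unset Printing Implicit Defensive.
Import Order.TTheory GRing.Theory Num.Theory.
Import numFieldNormedType.Exports.
Local Open Scope ring_scope.

(** In linear coordinates that diagonalize dX(0), the field reads X = S + h with
    S = sum_i lam_i x_i d/dx_i, all lam_i nonzero, and h of order at least 2.
    A monomial x^m has the weight <lam, m>, its eigenvalue under S.

    A formal change of coordinates Phi, tangent to the identity, brings X into
    Poincare-Dulac form Z = S + N, where N_i contains only monomials of weight
    lam_i ([formal_normal_form]).  A formal first integral of Z is killed by S
    and by N separately ([integral_resonant]).  Two independent ones have two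
    consequences.  First, S and N are parallel at the generic point, which
    forces N = g S with g a series of weight 0 ([parallel_of_integrals],
    [resonant_multiple]): formally, the foliation is that of a linear field.
    Second, there are two independent exponents p, q of weight 0, so lam is
    proportional to an integer vector and the numbers <lam, m> - lam_i that are
    not zero stay away from 0 ([weights_discrete]): there are no small divisors.

    This makes Phi = id + phi convergent.  Its equation reads, for the
    coefficients of x^m,
      (<lam, m> - lam_i) phi_i + <lam, m> (g phi_i) + N_i = h_i o Phi.
    The derivative S phi_i that multiplies g costs nothing, because the
    quotients <lam, m> / (<lam, m> - lam_i) are bounded: the coefficients of
    phi_i and of g x_i are dominated by those of h_i o Phi and of g phi_i
    ([formal_linearization]).  As h has order at least 2, a bound r for the
    l1-norm at radius r of the terms of phi of degree < N yields a bound O(r^2)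
    for the terms of degree < N + 1; for small r the bound r thus propagates to
    all degrees
    ([fconv_of_quadratic_gain]).  The same argument applies to the inverse of
    Phi ([fconv_inverse]).

    The monomials x^p and x^q are first integrals of Z = (1 + g) S.  Pulled back
    by the inverse of Phi, they become convergent first integrals of X, and
    independence of the vectors p and q is independence of the two functions.

    Convergent series and germs are related by termwise differentiation
    ([taylor_remainder], [taylor_diff]), by compatibility of the sum with
    products ([fevalM]) and by uniqueness of the expansion ([feval_eq0]). *)

(** * Exponents *)

Definition mdeg (m : mon3) : nat := (\sum_(i < 3) m i)%N.
Definition madd (p q : mon3) : mon3 := [ffun i => (p i + q i)%N].
Definition msub (p q : mon3) : mon3 := [ffun i => (p i - q i)%N].
Definition munit (i : 'I_3) : mon3 := [ffun j => (j == i) : nat].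
Definition mzero : mon3 := [ffun=> 0%N].

Lemma maddC p q : madd p q = madd q p.
Proof. by apply/ffunP => i; rewrite !ffunE addnC. Qed.

Lemma maddA p q r : madd p (madd q r) = madd (madd p q) r.
Proof. by apply/ffunP => i; rewrite !ffunE addnA. Qed.

Lemma madd0 p : madd p mzero = p.
Proof. by apply/ffunP => i; rewrite !ffunE addn0. Qed.

Lemma maddIr r p q : (madd p r == madd q r) = (p == q).
Proof.
apply/eqP/eqP => [/ffunP h|-> //]; apply/ffunP => i.
by have := h i; rewrite !ffunE => /eqP; rewrite eqn_add2r => /eqP.
Qed.

Lemma maddK p q : msub (madd p q) q = p.
Proof. by apply/ffunP => i; rewrite !ffunE addnK. Qed.

Lemma mdegD p q : mdeg (madd p q) = (mdeg p + mdeg q)%N.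
Proof. by rewrite /mdeg -big_split; apply: eq_bigr => i _; rewrite ffunE. Qed.

Lemma mdeg_unit i : mdeg (munit i) = 1%N.
Proof.
rewrite /mdeg (bigD1 i) //= ffunE eqxx big1 // => j /negbTE nij.
by rewrite ffunE nij.
Qed.

Lemma mdeg0 : mdeg mzero = 0%N.
Proof. by rewrite /mdeg big1 // => i _; rewrite ffunE. Qed.

Lemma mdeg_eq0 m : (mdeg m == 0)%N = (m == mzero).
Proof.
apply/idP/eqP => [|->]; last by rewrite mdeg0.
rewrite sum_nat_eq0 => /forallP h; apply/ffunP => i.
by rewrite ffunE; apply/eqP; exact: h.
Qed.

Lemma leq_mdeg (m : mon3) i : (m i <= mdeg m)%N.
Proof. by rewrite /mdeg (bigD1 i) //= leq_addr. Qed.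

(** All sums over exponents are taken over these lists: for the coefficients of
    degree < N of a product or of a substitution, any list [mons N'] with
    N <= N' gives the same value, by [sum_mons_widen]. *)
HB.lock Definition mons (N : nat) : seq mon3 :=
  [seq m <- [seq [ffun i => k i : nat] | k : {ffun 'I_3 -> 'I_N}] | mdeg m < N]%N.

Lemma mem_mons N m : (m \in mons N) = (mdeg m < N)%N.
Proof.
rewrite mons.unlock mem_filter; case: ltnP => //= h.
have hi i : (m i < N)%N by exact: leq_ltn_trans (leq_mdeg m i) h.
apply/mapP; exists [ffun i => Ordinal (hi i)]; first by rewrite mem_enum.
by apply/ffunP => i; rewrite !ffunE.
Qed.

Lemma mons_uniq N : uniq (mons N).
Proof.
rewrite mons.unlock filter_uniq // map_inj_uniq ?enum_uniq // => k k' /ffunP h.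
by apply/ffunP => i; apply: val_inj; move: (h i); rewrite !ffunE.
Qed.

Section Sums.
Variable V : zmodType.
Implicit Type F : mon3 -> V.

Lemma sum_mons_widen N N' (P : pred mon3) F : (N <= N')%N ->
  (forall p, P p -> (N <= mdeg p)%N -> F p = 0) ->
  \sum_(p <- mons N' | P p) F p = \sum_(p <- mons N | P p) F p.
Proof.
move=> leN h; rewrite (bigID (fun p => mdeg p < N)%N) /=.
rewrite [X in _ + X]big1 ?addr0; last first.
  by move=> p /andP[Pp]; rewrite -leqNgt; exact: h.
rewrite -big_filter -[RHS]big_filter; apply: perm_big; apply: uniq_perm.
- exact/filter_uniq/mons_uniq.
- exact/filter_uniq/mons_uniq.
move=> p; rewrite !mem_filter !mem_mons -andbA; congr (_ && _).
by apply/andP/idP => [[]//|pN]; split => //; exact: leq_trans pN leN.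
Qed.

Lemma sum_mons1 N (m : mon3) F : (mdeg m < N)%N ->
  \sum_(p <- mons N | p == m) F p = F m.
Proof.
move=> mN; rewrite -big_filter; rewrite (perm_big [:: m]) ?big_seq1 //.
apply: uniq_perm => //; first exact/filter_uniq/mons_uniq.
by move=> p; rewrite mem_filter mem_mons inE; case: eqP => // ->; rewrite mN.
Qed.
End Sums.

(** * The ring of formal power series *)

(** The wrapper separates the Cauchy product from the pointwise product which
    the type of functions carries canonically. *)
Record fser (K : numFieldType) := Fser { fcoef :> mon3 -> K }.

HB.lock Definition fmul (K : numFieldType) (a b : fser K) : fser K := Fser (fun m =>
  \sum_(p <- mons (mdeg m).+1) \sum_(q <- mons (mdeg m).+1 | madd p q == m)
     a p * b q).

Section Ring.
Variable K : numFieldType.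
Implicit Types a b c : fser K.

Lemma fserP a b : (forall m, a m = b m) <-> a = b.
Proof.
split=> [h|-> //]; case: a b h => a [b] /= h.
by congr Fser; apply: funext.
Qed.

HB.instance Definition _ := gen_eqMixin (fser K).
HB.instance Definition _ := gen_choiceMixin (fser K).

Definition fadd a b := Fser (fun m => a m + b m).
Definition fopp a := Fser (fun m => - a m).
Definition fzero : fser K := Fser (fun=> 0).

Lemma faddA : associative fadd.
Proof. by move=> a b c; apply/fserP => m /=; rewrite addrA. Qed.
Lemma faddC : commutative fadd.
Proof. by move=> a b; apply/fserP => m /=; rewrite addrC. Qed.
Lemma fadd0 : left_id fzero fadd.
Proof. by move=> a; apply/fserP => m /=; rewrite add0r. Qed.
Lemma faddN : left_inverse fzero fopp fadd.
Proof. by move=> a; apply/fserP => m /=; rewrite addNr. Qed.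

HB.instance Definition _ := GRing.isZmodule.Build (fser K) faddA faddC fadd0 faddN.

Lemma fcoefD a b m : (a + b) m = a m + b m. Proof. by []. Qed.
Lemma fcoefN a m : (- a) m = - a m. Proof. by []. Qed.
Lemma fcoefB a b m : (a - b) m = a m - b m. Proof. by []. Qed.
Lemma fcoef0 m : (0 : fser K) m = 0. Proof. by []. Qed.
Lemma fcoef_sum I (r : seq I) (P : pred I) (F : I -> fser K) m :
  (\sum_(i <- r | P i) F i) m = \sum_(i <- r | P i) F i m.
Proof. by elim/big_rec2: _ => // i x y _ <-. Qed.

Lemma fmulE N a b m : (mdeg m < N)%N -> fmul a b m =
  \sum_(p <- mons N) \sum_(q <- mons N | madd p q == m) a p * b q.
Proof.
move=> mN; rewrite fmul.unlock /= [RHS](@sum_mons_widen _ (mdeg m).+1) //; last first.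
  move=> p _ hp; rewrite big1 // => q /eqP E; move: hp.
  by rewrite -E mdegD; lia.
apply: eq_bigr => p _; rewrite [RHS](@sum_mons_widen _ (mdeg m).+1) //.
by move=> q /eqP E; rewrite -E mdegD; lia.
Qed.

Lemma fmulC : commutative (@fmul K).
Proof.
move=> a b; apply/fserP => m; rewrite fmul.unlock /= (exchange_big_dep predT) //=.
apply: eq_bigr => p _; apply: eq_big => [q|q _]; first by rewrite maddC.
by rewrite mulrC.
Qed.

Lemma fmulDl : left_distributive (@fmul K) fadd.
Proof.
move=> a b c; apply/fserP => m; rewrite fmul.unlock /= -big_split; apply: eq_bigr => p _.
by rewrite -big_split; apply: eq_bigr => q _; rewrite /= mulrDl.
Qed.

(** Associativity, through the symmetric sum over triples of exponents. *)
Lemma fmul3E a b c m : let N := (mdeg m).+1 in fmul (fmul a b) c m =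
  \sum_(p <- mons N) \sum_(q <- mons N)
     \sum_(r <- mons N | madd (madd p q) r == m) a p * b q * c r.
Proof.
move=> N; rewrite (@fmulE N) //.
transitivity (\sum_(s <- mons N) \sum_(p <- mons N)
    \sum_(q <- mons N | madd p q == s) \sum_(r <- mons N | madd s r == m)
       a p * b q * c r).
  rewrite big_seq [RHS]big_seq; apply: eq_bigr => s; rewrite mem_mons => sN.
  rewrite (fmulE _ _ sN).
  under eq_bigr do rewrite mulr_suml.
  rewrite exchange_big; apply: eq_bigr => p _ /=.
  under eq_bigr do rewrite mulr_suml.
  by rewrite exchange_big.
rewrite exchange_big; apply: eq_bigr => p _ /=.
rewrite (exchange_big_dep predT) //=; apply: eq_bigr => q _.
under eq_bigl do rewrite eq_sym.
case: (ltnP (mdeg (madd p q)) N) => h; first by rewrite sum_mons1.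
rewrite big_seq_cond big1; last first.
  by move=> s /andP[]; rewrite mem_mons => sN /eqP E; move: sN; rewrite E; lia.
rewrite big1 // => r /eqP E; move: h; rewrite /N -E !mdegD; lia.
Qed.

Lemma fmulA : associative (@fmul K).
Proof.
move=> a b c; rewrite (fmulC a); apply/fserP => m; rewrite !fmul3E.
set N := (mdeg m).+1.
transitivity (\sum_(q <- mons N) \sum_(r <- mons N) \sum_(p <- mons N)
   if madd (madd p q) r == m then a p * b q * c r else 0).
  apply: eq_bigr => q _; apply: eq_bigr => r _; rewrite big_mkcond.
  apply: eq_bigr => p _ /=; rewrite [madd (madd q r) p]maddC maddA.
  case: ifP => // _; by rewrite -[RHS]mulrA [RHS]mulrC.
rewrite [RHS]exchange_big /=; apply: eq_bigr => q _; rewrite exchange_big.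
by apply: eq_bigr => p _; rewrite -big_mkcond.
Qed.

Definition fone : fser K := Fser (fun m => (m == mzero)%:R).

Lemma fmul1 : left_id fone (@fmul K).
Proof.
move=> a; apply/fserP => m; rewrite fmul.unlock /=.
rewrite (bigID (pred1 mzero)) /= sum_mons1 ?mdeg0 //.
rewrite [X in _ + X]big1 ?addr0 => [|p /negbTE ->]; last first.
  by rewrite big1 // => q _; rewrite mul0r.
rewrite eqxx (eq_bigl (pred1 m)) ?sum_mons1 ?mul1r // => q.
by rewrite maddC madd0.
Qed.

Lemma fone_neq0 : fone != 0.
Proof.
apply/eqP => /fserP /(_ mzero) /=; rewrite eqxx; exact/eqP/oner_neq0.
Qed.

HB.instance Definition _ := GRing.Zmodule_isComNzRing.Build (fser K)
  fmulA fmulC fmul1 fmulDl fone_neq0.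

Lemma fcoefM N a b m : (mdeg m < N)%N -> (a * b) m =
  \sum_(p <- mons N) \sum_(q <- mons N | madd p q == m) a p * b q.
Proof. exact: fmulE. Qed.

End Ring.

(** * Monomials and derivations *)

Local Notation o0 := (0 : 'I_3).
Local Notation o1 := (1 : 'I_3).
Local Notation o2 := (ord_max : 'I_3).

Lemma ord3P (i : 'I_3) : [\/ i = o0, i = o1 | i = o2].
Proof.
by case: i => [[|[|[|]]]] // hi; [constructor 1|constructor 2|constructor 3]; exact/val_inj.
Qed.

Lemma mon_ind (P : mon3 -> Prop) : P mzero ->
  (forall m i, P m -> P (madd m (munit i))) -> forall m, P m.
Proof.
move=> P0 PS m; move: {2}(mdeg m) (erefl (mdeg m)) => n.
elim: n m => [|n IHn] m mn; first by move/eqP: mn; rewrite mdeg_eq0 => /eqP->.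
have [i mi] : exists i, m i != 0%N.
  apply/existsP; apply: contra_eqT mn => /existsPn h.
  by rewrite /mdeg big1 // => i _; apply/eqP/negPn/h.
have E : m = madd (msub m (munit i)) (munit i).
  apply/ffunP => j; rewrite !ffunE subnK //.
  by case: eqP => // ->; rewrite lt0n.
rewrite E; apply: PS; apply: IHn.
by move: mn; rewrite {1}E mdegD mdeg_unit addn1 => -[].
Qed.

Section Series.
Variable K : numFieldType.
Implicit Types (a b c : fser K) (Phi Psi : 'I_3 -> fser K).
Implicit Types m p q : mon3.

Definition fconst (x : K) : fser K := Fser (fun m => x * (m == mzero)%:R).
Definition fmon (p : mon3) : fser K := Fser (fun m => (m == p)%:R).
Definition fX i := fmon (munit i).
(** A diagonal operator on monomials: projections to weights, x_i d/dx_i and the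
    linear field S have this form. *)
Definition fmult (f : mon3 -> K) a : fser K := Fser (fun m => f m * a m).
Definition fderiv i a := Fser (fps3_deriv i a).
Definition powm Phi (m : mon3) : fser K := \prod_(i < 3) Phi i ^+ m i.

Lemma fconstB : {morph fconst : x y / x - y}.
Proof. by move=> x y; apply/fserP => m; rewrite fcoefB /= mulrBl. Qed.

Lemma fcoefCM x a m : (fconst x * a) m = x * a m.
Proof.
rewrite (@fcoefM _ (mdeg m).+1) // (bigID (pred1 mzero)) /=.
rewrite sum_mons1 ?mdeg0 // [X in _ + X]big1 ?addr0; last first.
  by move=> p /negbTE ->; rewrite big1 // => q _; rewrite mulr0 mul0r.
rewrite eqxx (eq_bigl (pred1 m)) ?sum_mons1 ?mulr1 // => q.
by rewrite maddC madd0.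
Qed.

Lemma fconstM : {morph fconst : x y / x * y}.
Proof. by move=> x y; apply/fserP => m; rewrite fcoefCM /= mulrA. Qed.
Lemma fconst1 : fconst 1 = 1.
Proof. by apply/fserP => m /=; rewrite mul1r. Qed.

HB.instance Definition _ := GRing.isZmodMorphism.Build K (fser K) fconst fconstB.
HB.instance Definition _ :=
  GRing.isMonoidMorphism.Build K (fser K) fconst (fconst1, fconstM).

Lemma fmon0 : fmon mzero = 1. Proof. by []. Qed.

Lemma fcoef_mulmon a p m : (a * fmon p) (madd m p) = a m.
Proof.
rewrite (@fcoefM _ (mdeg (madd m p)).+1) // (bigID (pred1 m)) /=.
rewrite sum_mons1 ?ltnS ?mdegD ?leq_addr // [X in _ + X]big1 ?addr0; last first.
  move=> q qm; rewrite big1 // => r; rewrite /= => /eqP E.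
  case: eqP => rp; last by rewrite mulr0.
  by move/eqP: E qm; rewrite rp maddIr => ->.
rewrite (eq_bigl (pred1 p)) ?sum_mons1 ?ltnS ?leq_addl //= ?eqxx ?mulr1 //.
by move=> q /=; rewrite maddC [madd m p]maddC maddIr.
Qed.

Lemma fcoef_mulmon0 a p m : (exists i, m i < p i)%N -> (a * fmon p) m = 0.
Proof.
case=> i mi; rewrite (@fcoefM _ (mdeg m).+1) // big1 // => q _.
rewrite big1 // => r /eqP E /=; case: eqP => rp; last by rewrite mulr0.
by move: mi; rewrite -E rp ffunE; lia.
Qed.

Lemma fmonD p q : fmon (madd p q) = fmon p * fmon q.
Proof.
apply/fserP => m; have [h|h] := pselect (exists i, m i < q i)%N.
  rewrite fcoef_mulmon0 //=; case: eqP => // E; case: h => i.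
  by rewrite E ffunE; lia.
have -> : m = madd (msub m q) q.
  apply/ffunP => i; rewrite !ffunE subnK // leqNgt.
  by apply/negP => hi; apply: h; exists i.
by rewrite fcoef_mulmon /= maddIr.
Qed.

(** Identities between derivatives are proved below for x_i d/dx_i, which acts
    diagonally on monomials, and then divided by x_i. *)
Lemma mulmonI p a b : a * fmon p = b * fmon p -> a = b.
Proof. by move=> /fserP h; apply/fserP => m; move: (h (madd m p)); rewrite !fcoef_mulmon. Qed.

Lemma fX_neq0 i : fX i != 0.
Proof. by apply/eqP => /fserP /(_ (munit i)) /=; rewrite eqxx => /eqP; rewrite oner_eq0. Qed.

Lemma powm_munit Phi i : powm Phi (munit i) = Phi i.
Proof.
rewrite /powm (bigD1 i) //= ffunE eqxx expr1 big1 ?mulr1 // => j /negbTE ji.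
by rewrite ffunE ji.
Qed.

Lemma powm0 Phi : powm Phi mzero = 1.
Proof. by rewrite /powm big1 // => i _; rewrite ffunE. Qed.

Lemma powmD Phi p q : powm Phi (madd p q) = powm Phi p * powm Phi q.
Proof. by rewrite /powm -big_split; apply: eq_bigr => i _; rewrite ffunE exprD. Qed.

Lemma powmX m : powm fX m = fmon m.
Proof.
elim/mon_ind: m => [|m i IH]; first by rewrite powm0 fmon0.
by rewrite powmD powm_munit IH fmonD.
Qed.

Lemma fmultD f : {morph fmult f : a b / a + b}.
Proof. by move=> a b; apply/fserP => m; rewrite /= mulrDr. Qed.
Lemma fmultB f : {morph fmult f : a b / a - b}.
Proof. by move=> a b; apply/fserP => m; rewrite /= mulrBr. Qed.

Lemma fmult_leibniz f a b : (forall p q, f (madd p q) = f p + f q) ->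
  fmult f (a * b) = fmult f a * b + a * fmult f b.
Proof.
move=> hf; apply/fserP => m; rewrite fcoefD /=.
rewrite !(@fcoefM _ (mdeg m).+1) // -big_split mulr_sumr; apply: eq_bigr => p _.
rewrite -big_split mulr_sumr; apply: eq_bigr => q /eqP <- /=.
by rewrite hf; ring.
Qed.

Lemma fderivE i a m : fderiv i a m = (m i).+1%:R * a (madd m (munit i)).
Proof.
rewrite /= /fps3_deriv; congr (_ * fcoef a _).
by apply/ffunP => j; rewrite !ffunE.
Qed.

Lemma mulX_deriv i a : fderiv i a * fX i = fmult (fun m => (m i)%:R) a.
Proof.
apply/fserP => m /=; case: (posnP (m i)) => h.
  by rewrite h mul0r fcoef_mulmon0 //; exists i; rewrite ffunE eqxx; lia.
have -> : m = madd (msub m (munit i)) (munit i).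
  by apply/ffunP => j; rewrite !ffunE subnK //; case: eqP => // ->.
by rewrite fcoef_mulmon fderivE !ffunE eqxx addn1.
Qed.

Lemma fderivD i : {morph fderiv i : a b / a + b}.
Proof. by move=> a b; apply/fserP => m; rewrite fcoefD !fderivE mulrDr. Qed.
Lemma fderivB i : {morph fderiv i : a b / a - b}.
Proof. by move=> a b; apply/fserP => m; rewrite fcoefB !fderivE mulrBr. Qed.
HB.instance Definition _ i :=
  GRing.isZmodMorphism.Build (fser K) (fser K) (fderiv i) (@fderivB i).

Lemma fderivM i a b : fderiv i (a * b) = fderiv i a * b + a * fderiv i b.
Proof.
apply: (@mulmonI (munit i)); rewrite -/(fX i) mulX_deriv fmult_leibniz.
  by rewrite -!mulX_deriv; ring.
by move=> p q; rewrite ffunE natrD.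
Qed.

Lemma fderiv_const i x : fderiv i (fconst x) = 0.
Proof.
apply/fserP => m; rewrite fderivE /= -mdeg_eq0 mdegD mdeg_unit addn1 /=.
by rewrite !mulr0.
Qed.

Lemma fderivX i j : fderiv i (fX j) = (i == j)%:R.
Proof.
apply: (@mulmonI (munit i)); rewrite -/(fX i) mulX_deriv; apply/fserP => m /=.
have -> : ((i == j)%:R : fser K) * fX i = fconst (i == j)%:R * fX i.
  by case: (i == j); rewrite ?fconst1 // ?mul0r; apply/fserP => k; rewrite fcoefCM mul0r.
rewrite fcoefCM /=; have [->|] := eqVneq m (munit j).
  rewrite ffunE mulr1; have [->|nij] := eqVneq i j; first by rewrite eqxx mulr1.
  by rewrite mul0r.
have [->|_] := eqVneq i j; last by rewrite mulr0 mul0r.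
by move=> /negbTE ->; rewrite !mulr0.
Qed.

(** * Order of a series *)

Definition ord_ge (n : nat) a := forall m, (mdeg m < n)%N -> a m = 0.

Lemma ord_geW n n' a : (n <= n')%N -> ord_ge n' a -> ord_ge n a.
Proof. by move=> h ha m hm; apply: ha; exact: leq_trans hm h. Qed.
Lemma ord_geD n a b : ord_ge n a -> ord_ge n b -> ord_ge n (a + b).
Proof. by move=> ha hb m hm; rewrite fcoefD ha ?hb ?addr0. Qed.
Lemma ord_geN n a : ord_ge n a -> ord_ge n (- a).
Proof. by move=> ha m hm; rewrite fcoefN ha ?oppr0. Qed.
Lemma ord_geB n a b : ord_ge n a -> ord_ge n b -> ord_ge n (a - b).
Proof. by move=> ha hb; apply: ord_geD => //; apply: ord_geN. Qed.
Lemma ord_ge_sum n I (r : seq I) (P : pred I) (F : I -> fser K) :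
  (forall i, P i -> ord_ge n (F i)) -> ord_ge n (\sum_(i <- r | P i) F i).
Proof. by move=> h; elim/big_ind: _ => //; exact: ord_geD. Qed.
Lemma ord_geM n n' a b : ord_ge n a -> ord_ge n' b -> ord_ge (n + n') (a * b).
Proof.
move=> ha hb m hm; rewrite (@fcoefM _ (mdeg m).+1) // big1 // => p _.
rewrite big1 // => q /eqP E; case: (ltnP (mdeg p) n) => h; first by rewrite ha // mul0r.
by rewrite hb ?mulr0 //; move: hm; rewrite -E mdegD; lia.
Qed.
Lemma ord_geMl n a b : ord_ge n a -> ord_ge n (a * b).
Proof. by move=> ha; rewrite -[n]addn0; exact: ord_geM. Qed.
Lemma ord_geMr n a b : ord_ge n a -> ord_ge n (b * a).
Proof. by rewrite mulrC; exact: ord_geMl. Qed.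
Lemma ord_ge_mult n f a : ord_ge n a -> ord_ge n (fmult f a).
Proof. by move=> h m hm /=; rewrite h ?mulr0. Qed.
Lemma ord_ge_deriv n i a : ord_ge n.+1 a -> ord_ge n (fderiv i a).
Proof. by move=> h m hm; rewrite fderivE h ?mulr0 // mdegD mdeg_unit addn1. Qed.
Lemma ord_geX i : ord_ge 1 (fX i).
Proof.
move=> m; rewrite ltnS leqn0 mdeg_eq0 => /eqP -> /=; case: eqP => // /ffunP /(_ i).
by rewrite !ffunE eqxx.
Qed.
Lemma ord_ge_mon m : ord_ge (mdeg m) (fmon m).
Proof. by move=> p hp /=; case: eqP hp => // ->; rewrite ltnn. Qed.
Lemma ord_ge_powm Phi m : (forall i, ord_ge 1 (Phi i)) -> ord_ge (mdeg m) (powm Phi m).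
Proof.
move=> h; elim/mon_ind: m => [|m i IH]; first by rewrite mdeg0.
by rewrite mdegD mdeg_unit powmD powm_munit; exact: ord_geM.
Qed.
Lemma ord_ge_eq0 a : (forall n, ord_ge n a) -> a = 0.
Proof. by move=> h; apply/fserP => m; apply: (h (mdeg m).+1). Qed.

Definition ftrunc n a : fser K := Fser (fun m => if (mdeg m < n)%N then a m else 0).

Lemma ord_ge_trunc n a : ord_ge n (a - ftrunc n a).
Proof. by move=> m hm; rewrite fcoefB /= hm subrr. Qed.

Lemma ftruncE n a : ftrunc n a = \sum_(p <- mons n) fconst (a p) * fmon p.
Proof.
apply/fserP => m; rewrite fcoef_sum /=.
under eq_bigr do rewrite fcoefCM /= eq_sym.
case: ltnP => h.
  rewrite (bigID (pred1 m)) /= sum_mons1 // eqxx mulr1 big1 ?addr0 //.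
  by move=> p /negbTE ->; rewrite mulr0.
rewrite big_seq big1 // => p; rewrite mem_mons => hp.
by case: eqP hp => [->|]; [lia | rewrite mulr0].
Qed.

(** Polynomials are dense: an additive operator that is continuous for the order
    filtration, with a loss of at most one degree (as for a derivation), is
    determined by its values on monomials. *)
Lemma cont_additive_eq0 (L : fser K -> fser K) :
  {morph L : a b / a + b} ->
  (forall n a, ord_ge n.+1 a -> ord_ge n (L a)) ->
  (forall x m, L (fconst x * fmon m) = 0) -> forall a, L a = 0.
Proof.
move=> LD Lc Lm a; apply: ord_ge_eq0 => n.
have L0 : L 0 = 0 by have := LD 0 0; rewrite addr0 => /eqP; rewrite -subr_eq subrr => /eqP.
rewrite -(subrK (ftrunc n.+1 a) a) LD [in X in _ + X]ftruncE (big_morph L LD L0) /=.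
apply: ord_geD; first by apply: Lc; exact: ord_ge_trunc.
by rewrite big1.
Qed.

(** * Substitution *)

(** The truncation of the sum at the degree of m is harmless when the series Phi
    have no constant term, since Phi^k then has order at least the degree of k. *)
Definition fcomp a Phi : fser K := Fser (fun m =>
  \sum_(k <- mons (mdeg m).+1) a k * powm Phi k m).

Section Comp.
Variable Phi : 'I_3 -> fser K.
Hypothesis Phi1 : forall i, ord_ge 1 (Phi i).

Lemma fcompE N a m : (mdeg m < N)%N ->
  fcomp a Phi m = \sum_(k <- mons N) a k * powm Phi k m.
Proof.
move=> h; rewrite /= [RHS](@sum_mons_widen _ (mdeg m).+1) // => p _ hp.
by rewrite (ord_ge_powm Phi1) ?mulr0.
Qed.

Lemma fcompD : {morph fcomp^~ Phi : a b / a + b}.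
Proof.
move=> a b; apply/fserP => m; rewrite fcoefD /= -big_split.
by apply: eq_bigr => k _; rewrite mulrDl.
Qed.
Lemma fcomp0 : fcomp 0 Phi = 0.
Proof. by apply/fserP => m /=; rewrite big1 // => k _; rewrite mul0r. Qed.
Lemma fcomp_sum I (r : seq I) (P : pred I) (F : I -> fser K) :
  fcomp (\sum_(i <- r | P i) F i) Phi = \sum_(i <- r | P i) fcomp (F i) Phi.
Proof. exact: (big_morph _ fcompD fcomp0). Qed.

Lemma ord_ge_comp n a : ord_ge n a -> ord_ge n (fcomp a Phi).
Proof.
move=> h m hm /=; rewrite big_seq big1 // => k; rewrite mem_mons => hk.
by rewrite h ?mul0r //; lia.
Qed.

Lemma fcomp_cmon x m : fcomp (fconst x * fmon m) Phi = fconst x * powm Phi m.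
Proof.
apply/fserP => k; rewrite (@fcompE (maxn (mdeg k) (mdeg m)).+1) ?ltnS ?leq_maxl //.
rewrite (bigID (pred1 m)) /= sum_mons1 ?ltnS ?leq_maxr // big1 ?addr0.
  by rewrite !fcoefCM /= eqxx mulr1.
by move=> p /negbTE h; rewrite fcoefCM /= h mulr0 mul0r.
Qed.

Lemma fcomp_mon m : fcomp (fmon m) Phi = powm Phi m.
Proof. by have := fcomp_cmon 1 m; rewrite fconst1 !mul1r. Qed.
Lemma fcompX i : fcomp (fX i) Phi = Phi i.
Proof. by rewrite fcomp_mon powm_munit. Qed.
Lemma fcomp_const x : fcomp (fconst x) Phi = fconst x.
Proof. by have := fcomp_cmon x mzero; rewrite fmon0 powm0 !mulr1. Qed.
Lemma fcomp1 : fcomp 1 Phi = 1. Proof. by rewrite -fconst1 fcomp_const. Qed.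
Lemma fcompM : {morph fcomp^~ Phi : a b / a * b}.
Proof.
move=> a b; apply/eqP; rewrite -subr_eq0; apply/eqP.
apply: (@cont_additive_eq0 (fun a => fcomp (a * b) Phi - fcomp a Phi * fcomp b Phi)).
- by move=> x y; rewrite mulrDl !fcompD; ring.
- move=> n x /(ord_geW (leqnSn n)) h; apply: ord_geB.
    by apply/ord_ge_comp/ord_geMl.
  by apply/ord_geMl/ord_ge_comp.
move=> x m {a}; set a := fconst x * fmon m.
apply: (@cont_additive_eq0 (fun b => fcomp (a * b) Phi - fcomp a Phi * fcomp b Phi)).
- by move=> y z; rewrite mulrDr !fcompD; ring.
- move=> n y /(ord_geW (leqnSn n)) h; apply: ord_geB.
    by apply/ord_ge_comp/ord_geMr.
  by apply/ord_geMr/ord_ge_comp.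
move=> y m'; rewrite /a mulrACA -fmonD -rmorphM !fcomp_cmon powmD rmorphM /=.
by ring.
Qed.

Lemma fcomp_powm Psi m : fcomp (powm Psi m) Phi = powm (fun i => fcomp (Psi i) Phi) m.
Proof.
elim/mon_ind: m => [|m i IH]; first by rewrite !powm0 fcomp1.
by rewrite !powmD !powm_munit fcompM IH.
Qed.

End Comp.

Lemma fcomp_id a : fcomp a fX = a.
Proof.
apply/fserP => m; rewrite /= (bigID (pred1 m)) /= sum_mons1 // powmX /= eqxx mulr1.
by rewrite big1 ?addr0 // => p /negbTE h; rewrite powmX /= eq_sym h mulr0.
Qed.

Lemma fcompA a Phi Psi : (forall i, ord_ge 1 (Phi i)) -> (forall i, ord_ge 1 (Psi i)) ->
  fcomp (fcomp a Phi) Psi = fcomp a (fun i => fcomp (Phi i) Psi).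
Proof.
move=> h1 h2; have h3 i : ord_ge 1 (fcomp (Phi i) Psi) by exact: ord_ge_comp.
apply/eqP; rewrite -subr_eq0; apply/eqP; apply: (@cont_additive_eq0
  (fun a => fcomp (fcomp a Phi) Psi - fcomp a (fun i => fcomp (Phi i) Psi))).
- by move=> x y; rewrite !fcompD //; ring.
- move=> n x /(ord_geW (leqnSn n)) h.
  by apply: ord_geB; do ?apply: ord_ge_comp.
by move=> x m; rewrite !fcomp_cmon // fcompM // fcomp_const // fcomp_powm // subrr.
Qed.

Lemma fcomp_inverse a Phi Psi : (forall i, ord_ge 1 (Phi i)) -> (forall i, ord_ge 1 (Psi i)) ->
  (forall i, fcomp (Phi i) Psi = fX i) -> fcomp (fcomp a Phi) Psi = a.
Proof.
move=> h1 h2 e; rewrite fcompA // (_ : (fun i => _) = fX) ?fcomp_id //.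
exact: funext.
Qed.

Lemma chain_rule j a Phi : (forall i, ord_ge 1 (Phi i)) ->
  fderiv j (fcomp a Phi) = \sum_i fcomp (fderiv i a) Phi * fderiv j (Phi i).
Proof.
move=> h1; pose L a := fderiv j (fcomp a Phi) - \sum_i fcomp (fderiv i a) Phi * fderiv j (Phi i).
apply/eqP; rewrite -subr_eq0; apply/eqP; apply: (@cont_additive_eq0 L).
- move=> x y; rewrite /L fcompD fderivD.
  under eq_bigr do rewrite fderivD fcompD // mulrDl.
  by rewrite big_split /=; ring.
- move=> n x h; apply: ord_geB; first by apply/ord_ge_deriv/ord_ge_comp.
  by apply: ord_ge_sum => i _; apply/ord_geMl/ord_ge_comp/ord_ge_deriv.
have LM x y : L x = 0 -> L y = 0 -> L (x * y) = 0.
  move=> /eqP; rewrite /L subr_eq0 => /eqP hx /eqP; rewrite subr_eq0 => /eqP hy.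
  apply/eqP; rewrite subr_eq0 fcompM // fderivM hx hy; apply/eqP.
  rewrite mulr_suml mulr_sumr -big_split; apply: eq_bigr => i _ /=.
  by rewrite fderivM fcompD // !fcompM //; ring.
have LX i : L (fX i) = 0.
  rewrite /L fcompX // (bigD1 i) //= fderivX eqxx fcomp1 // mul1r.
  rewrite big1 ?addr0 ?subrr // => k /negbTE h.
  by rewrite fderivX h fcomp0 // mul0r.
have LC x : L (fconst x) = 0.
  rewrite /L fcomp_const // fderiv_const big1 ?subrr // => i _.
  by rewrite fderiv_const fcomp0 // mul0r.
move=> x m; apply: (LM) => //; elim/mon_ind: m => [|m i IH].
  by rewrite fmon0 -fconst1 LC.
by rewrite fmonD; apply: LM => //; exact: LX.
Qed.

(** * Vector fields and changes of coordinates *)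

Definition lie Y a := \sum_(i < 3) Y i * fderiv i a.

Lemma lieD Y : {morph lie Y : a b / a + b}.
Proof.
move=> a b; rewrite /lie -big_split; apply: eq_bigr => i _.
by rewrite fderivD mulrDr.
Qed.

Lemma lieX Y i : lie Y (fX i) = Y i.
Proof.
rewrite /lie (bigD1 i) //= fderivX eqxx mulr1 big1 ?addr0 // => k /negbTE h.
by rewrite fderivX h mulr0.
Qed.

Lemma lie_comp Y Phi a : (forall i, ord_ge 1 (Phi i)) ->
  lie Y (fcomp a Phi) = \sum_i fcomp (fderiv i a) Phi * lie Y (Phi i).
Proof.
move=> h; rewrite /lie; under eq_bigr do rewrite chain_rule // mulr_sumr.
rewrite exchange_big; apply: eq_bigr => i _ /=; rewrite mulr_sumr.
by apply: eq_bigr => j _; ring.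
Qed.

(** The map Phi carries the vector field Y to the vector field X. *)
Definition frelated Y X Phi := forall i, lie Y (Phi i) = fcomp (X i) Phi.

Lemma lie_related Y X Phi a : (forall i, ord_ge 1 (Phi i)) -> frelated Y X Phi ->
  lie Y (fcomp a Phi) = fcomp (lie X a) Phi.
Proof.
move=> h hr; rewrite lie_comp // [lie X a]/lie fcomp_sum; apply: eq_bigr => i _.
by rewrite hr fcompM // mulrC.
Qed.

(** No Jacobian matrix has to be inverted: it suffices to apply [lie_related] to
    the components of Psi, whose pullbacks by Phi are the coordinates. *)
Lemma frelated_inv Y X Phi Psi : (forall i, ord_ge 1 (Phi i)) ->
  (forall i, ord_ge 1 (Psi i)) ->
  (forall i, fcomp (Psi i) Phi = fX i) -> (forall i, fcomp (Phi i) Psi = fX i) ->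
  frelated Y X Phi -> frelated X Y Psi.
Proof.
move=> h1 h2 e1 e2 hr i; have := lie_related (Psi i) h1 hr.
by rewrite e1 lieX => ->; rewrite fcomp_inverse.
Qed.

Definition fwedge a b i j := fderiv i a * fderiv j b - fderiv j a * fderiv i b.

(** The pullback of the 2-form da /\ db by Phi has coefficients which are
    combinations of the pulled back coefficients of da /\ db. *)
Lemma fwedge_comp_eq0 a b Phi : (forall i, ord_ge 1 (Phi i)) ->
  (forall i j, fwedge a b i j = 0) ->
  forall i j, fwedge (fcomp a Phi) (fcomp b Phi) i j = 0.
Proof.
move=> h1 h i j; rewrite /fwedge !chain_rule //.
have E (A B : 'I_3 -> fser K) : (\sum_k fcomp (fderiv k a) Phi * A k) *
    (\sum_k fcomp (fderiv k b) Phi * B k) =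
    \sum_k \sum_l fcomp (fderiv k a * fderiv l b) Phi * (A k * B l).
  rewrite mulr_suml; apply: eq_bigr => k _; rewrite mulr_sumr.
  by apply: eq_bigr => l _; rewrite fcompM //; ring.
rewrite !E [X in _ - X]exchange_big -sumrB big1 // => k _.
rewrite -sumrB big1 // => l _ /=.
have -> : fderiv k a * fderiv l b = fderiv l a * fderiv k b.
  by apply/eqP; rewrite -subr_eq0; apply/eqP; exact: h.
by ring.
Qed.

Lemma fwedge_comp_neq0 a b Phi Psi :
  (forall i, ord_ge 1 (Phi i)) -> (forall i, ord_ge 1 (Psi i)) ->
  (forall i, fcomp (Phi i) Psi = fX i) ->
  (exists i j, fwedge a b i j != 0) ->
  exists i j, fwedge (fcomp a Phi) (fcomp b Phi) i j != 0.
Proof.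
move=> h1 h2 e [i [j /eqP w]]; apply: contrapT => /forallNP h; apply: w.
rewrite -(fcomp_inverse a h1 h2 e) -(fcomp_inverse b h1 h2 e).
apply: fwedge_comp_eq0 => // k l.
by apply/eqP/negPn/negP => ne; apply: (h k); exists l.
Qed.

(** * Absence of zero divisors *)

(** The product of the lexicographically first terms of a and b is the
    lexicographically first term of a b. *)
Lemma fmul_eq0 a b : a * b = 0 -> a = 0 \/ b = 0.
Proof.
move=> ab; apply: contrapT => /not_orP[a0 b0].
have supp c : c <> 0 -> exists m, c m != 0.
  move=> c0; apply: contrapT => /forallNP h; apply: c0; apply/fserP => m.
  by apply/eqP/negPn/negP/h.
(* The first term is found coordinate by coordinate. *)
have lexmin c : c <> 0 -> exists2 p, c p != 0 & forall q, c q != 0 ->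
    [\/ p = q, (p o0 < q o0)%N, p o0 = q o0 /\ (p o1 < q o1)%N |
        [/\ p o0 = q o0, p o1 = q o1 & (p o2 < q o2)%N]].
  move=> /supp[m cm].
  have E0 : exists n, `[< exists2 p : mon3, c p != 0 & p o0 = n >].
    by exists (m o0); apply/asboolP; exists m.
  case: (ex_minnP E0) => n0 /asboolP[p0 cp0 e0] min0.
  have E1 : exists n, `[< exists2 p : mon3, c p != 0 & p o0 = n0 /\ p o1 = n >].
    by exists (p0 o1); apply/asboolP; exists p0.
  case: (ex_minnP E1) => n1 /asboolP[p1 cp1 [e10 e11]] min1.
  have E2 : exists n, `[< exists2 p : mon3, c p != 0 &
      [/\ p o0 = n0, p o1 = n1 & p o2 = n] >].
    by exists (p1 o2); apply/asboolP; exists p1.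
  case: (ex_minnP E2) => n2 /asboolP[p cp [e20 e21 e22]] min2.
  exists p => // q cq; have h0 : (n0 <= q o0)%N by apply: min0; apply/asboolP; exists q.
  move: h0; rewrite leq_eqVlt => /orP[/eqP h0|h0]; last by constructor 2; rewrite e20.
  have h1 : (n1 <= q o1)%N by apply: min1; apply/asboolP; exists q.
  move: h1; rewrite leq_eqVlt => /orP[/eqP h1|h1]; last by constructor 3; rewrite e20 e21.
  have h2 : (n2 <= q o2)%N by apply: min2; apply/asboolP; exists q.
  move: h2; rewrite leq_eqVlt => /orP[/eqP h2|h2]; last first.
    by constructor 4; rewrite e20 e21 e22.
  constructor 1; apply/ffunP => i.
  have [->|->|->] := ord3P i.
  - by rewrite e20.
  - by rewrite e21.
  - by rewrite e22.
have [p ap minp] := lexmin a a0; have [q bq minq] := lexmin b b0.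
move/fserP: ab => /(_ (madd p q)); rewrite fcoef0 => /eqP.
rewrite (@fcoefM _ (mdeg (madd p q)).+1) // (bigID (pred1 p)) /=.
rewrite sum_mons1 ?ltnS ?mdegD ?leq_addr // [X in _ + X]big1 ?addr0; last first.
  move=> p' np; rewrite big1 // => q' /eqP /ffunP E.
  apply/eqP; rewrite mulf_eq0; apply/negPn/negP; rewrite negb_or => /andP[ap' bq'].
  have E0 := E o0; have E1 := E o1; have E2 := E o2; move: E0 E1 E2; rewrite !ffunE.
  case: (minp _ ap') => [pp||[]|[]]; first by rewrite pp eqxx in np.
  - by case: (minq _ bq') => [->||[]|[]]; lia.
  - by case: (minq _ bq') => [->||[]|[]]; lia.
  - by case: (minq _ bq') => [->||[]|[]]; lia.
rewrite (eq_bigl (pred1 q)); last by move=> r; rewrite maddC [madd p q]maddC maddIr.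
by rewrite sum_mons1 ?ltnS ?leq_addl // mulf_eq0 (negbTE ap) (negbTE bq).
Qed.
End Series.

(** * Fixed points and formal inverses *)

Section FixedPoint.
Variable K : numFieldType.
Implicit Types (a b c h : fser K) (Phi Psi y z : 'I_3 -> fser K).
Implicit Types m p q : mon3.

Lemma ord_ge_powmB n Phi Psi m :
  (forall i, ord_ge 1 (Phi i)) -> (forall i, ord_ge 1 (Psi i)) ->
  (forall i, ord_ge n.+1 (Phi i - Psi i)) ->
  ord_ge (n + mdeg m) (powm Phi m - powm Psi m).
Proof.
move=> h1 h2 h; elim/mon_ind: m => [|m i IH]; first by rewrite !powm0 subrr.
rewrite !powmD !powm_munit mdegD mdeg_unit.
have -> : powm Phi m * Phi i - powm Psi m * Psi i =
  powm Phi m * (Phi i - Psi i) + (powm Phi m - powm Psi m) * Psi i by ring.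
apply: ord_geD.
  by have := ord_geM (ord_ge_powm (m := m) h1) (h i); rewrite addn1 addnS addnC -addnS.
by rewrite addnA; exact: ord_geM.
Qed.

(** Since h starts in degree 2, perturbing the argument in degree n + 1 changes
    the result only from degree n + 2 on. *)
Lemma ord_ge_compB n h Phi Psi : ord_ge 2 h ->
  (forall i, ord_ge 1 (Phi i)) -> (forall i, ord_ge 1 (Psi i)) ->
  (forall i, ord_ge n.+1 (Phi i - Psi i)) ->
  ord_ge n.+2 (fcomp h Phi - fcomp h Psi).
Proof.
move=> h2 p1 p2 hd m hm; rewrite fcoefB /= -sumrB big1 // => k _.
rewrite -mulrBr; case: (ltnP (mdeg k) 2) => hk; first by rewrite h2 ?mul0r.
by rewrite -fcoefB (ord_ge_powmB p1 p2 hd) ?mulr0 //; lia.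
Qed.

(** Picard iteration from 0: the iterates of a map that gains one order
    stabilize degree by degree. *)
Lemma fixed_point (T : ('I_3 -> fser K) -> 'I_3 -> fser K) :
  (forall y, (forall i, ord_ge 2 (y i)) -> forall i, ord_ge 2 (T y i)) ->
  (forall n y z, (forall i, ord_ge 2 (y i)) -> (forall i, ord_ge 2 (z i)) ->
     (forall i, ord_ge n.+2 (y i - z i)) -> forall i, ord_ge n.+3 (T y i - T z i)) ->
  exists2 y, (forall i, ord_ge 2 (y i)) & (forall i, T y i = y i).
Proof.
move=> T2 Tc; pose Y n := iter n T (fun=> 0).
have Y2 n i : ord_ge 2 (Y n i) by elim: n i => [|n IH] i //; exact: T2.
have YS n i : ord_ge n.+2 (Y n.+1 i - Y n i).
  elim: n i => [|n IH] i; first by rewrite subr0; exact: Y2.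
  exact: (Tc n (Y n.+1) (Y n)).
have YD n k i : ord_ge n.+2 (Y (n + k)%N i - Y n i).
  elim: k => [|k IH]; first by rewrite addn0 subrr.
  rewrite addnS -(subrK (Y (n + k)%N i) (Y (n + k).+1 i)) -addrA.
  by apply: ord_geD => //; apply: ord_geW (YS _ _); rewrite !ltnS leq_addr.
pose y i := Fser (fun m => Y (mdeg m) i m).
have yY n i : ord_ge n.+2 (y i - Y n i).
  move=> m hm; rewrite fcoefB /=; case: (leqP (mdeg m) n) => h.
    have := YD (mdeg m) (n - mdeg m)%N i m; rewrite subnKC // fcoefB.
    by move=> /(_ (ltnW (leqnn _))) /eqP; rewrite subr_eq0 => /eqP ->; rewrite subrr.
  have -> : mdeg m = n.+1 by lia.
  by have := YS n i m; rewrite fcoefB => ->.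
have y2 i : ord_ge 2 (y i) by rewrite -[y i]subr0; exact: (yY 0%N).
exists y => // i; apply/eqP; rewrite -subr_eq0; apply/eqP; apply: ord_ge_eq0 => n.
apply: (@ord_geW _ n n.+3); first by lia.
rewrite -(subrK (Y n.+1 i) (T y i)) -addrA; apply: ord_geD.
  exact: (Tc n y (Y n)).
by rewrite -opprB; apply/ord_geN/yY.
Qed.

Definition near_id phi : 'I_3 -> fser K := fun i => fX K i + phi i.

Lemma near_id1 phi : (forall i, ord_ge 2 (phi i)) -> forall i, ord_ge 1 (near_id phi i).
Proof.
by move=> h i; apply: ord_geD; [exact: ord_geX | apply: ord_geW (h i)].
Qed.

Lemma near_idB phi psi i : near_id phi i - near_id psi i = phi i - psi i.
Proof. by rewrite /near_id; ring. Qed.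

(** The inverse id + psi of id + phi is the fixed point of
    psi |-> - phi o (id + psi). *)
Lemma right_inverse phi : (forall i, ord_ge 2 (phi i)) ->
  exists psi, [/\ forall i, ord_ge 2 (psi i),
    forall i, psi i = - fcomp (phi i) (near_id psi) &
    forall i, fcomp (near_id phi i) (near_id psi) = fX K i].
Proof.
move=> h2; have [|n y z y2 z2 yz i|psi p2 ep] :=
  @fixed_point (fun psi i => - fcomp (phi i) (near_id psi)).
- by move=> y y2 i; apply/ord_geN/ord_ge_comp.
- rewrite -opprD; apply: ord_geN; apply: ord_ge_compB => //; try exact: near_id1.
  by move=> j; rewrite near_idB.
exists psi; split=> // i; rewrite {1}/near_id fcompD fcompX; last exact: near_id1.
by rewrite /near_id -[psi i]ep; ring.
Qed.

(** A right inverse which itself has a right inverse is two-sided. *)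
Lemma near_id_inverse phi : (forall i, ord_ge 2 (phi i)) ->
  exists psi, [/\ forall i, ord_ge 2 (psi i),
    forall i, psi i = - fcomp (phi i) (near_id psi),
    forall i, fcomp (near_id phi i) (near_id psi) = fX K i &
    forall i, fcomp (near_id psi i) (near_id phi) = fX K i].
Proof.
move=> h2; have [psi [p2 e r]] := right_inverse h2; exists psi; split => // i.
have [chi [c2 _ r']] := right_inverse p2.
suff -> : near_id phi = near_id chi by [].
apply: funext => j; rewrite -[near_id phi j]fcomp_id.
rewrite (_ : fX K = fun k => fcomp (near_id psi k) (near_id chi)); last first.
  by apply: funext => k; rewrite r'.
rewrite -fcompA ?r ?fcompX //; exact: near_id1.
Qed.

End FixedPoint.

(** * The formal normal form *)

Section NormalForm.
Variable K : numFieldType.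
Variable lam : 'I_3 -> K.
Implicit Types (a b c h : fser K) (Phi Psi y z N : 'I_3 -> fser K).
Implicit Types m p q : mon3.

(** The eigenvalue of S = sum_i lam_i x_i d/dx_i on x^m. *)
Definition wt m := \sum_(i < 3) lam i * (m i)%:R.

Lemma wtD p q : wt (madd p q) = wt p + wt q.
Proof.
rewrite /wt -big_split; apply: eq_bigr => i _.
by rewrite ffunE natrD mulrDr.
Qed.

Lemma wt_unit i : wt (munit i) = lam i.
Proof.
rewrite /wt (bigD1 i) //= ffunE eqxx mulr1 big1 ?addr0 // => j /negbTE h.
by rewrite ffunE h mulr0.
Qed.

Definition diag_vf : 'I_3 -> fser K := fun i => fconst (lam i) * fX K i.

Lemma lie_diag a : lie diag_vf a = fmult wt a.
Proof.
apply/fserP => m; rewrite /lie fcoef_sum /= /wt mulr_suml; apply: eq_bigr => i _.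
by rewrite /diag_vf -mulrA fcoefCM [fX K i * _]mulrC mulX_deriv /= mulrA.
Qed.

Definition addvf Y N : 'I_3 -> fser K := fun i => Y i + N i.

Lemma lie_addvf Y N a : lie (addvf Y N) a = lie Y a + lie N a.
Proof.
by rewrite /lie -big_split; apply: eq_bigr => i _; rewrite /addvf mulrDl.
Qed.

(** The resonant part of each coefficient equation determines N and the rest
    determines phi, which is normalized to have no resonant terms.  A single
    family y = phi + N encodes both unknowns, as its two weight components, and
    is obtained as a fixed point. *)
Lemma formal_normal_form (h : 'I_3 -> fser K) : (forall i, ord_ge 2 (h i)) ->
  exists phi N : 'I_3 -> fser K,
  [/\ (forall i, ord_ge 2 (phi i)) /\ (forall i, ord_ge 2 (N i)),
      forall i m, wt m = lam i -> phi i m = 0,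
      forall i m, N i m != 0 -> wt m = lam i &
      frelated (addvf diag_vf N) (addvf diag_vf h) (near_id phi)].
Proof.
move=> h2.
pose res i := fmult (fun m => (wt m == lam i)%:R : K).
pose nr i := fmult (fun m => (wt m != lam i)%:R : K).
pose L i := fmult (fun m => if wt m == lam i then 1 else (wt m - lam i)^-1).
pose F y i := fcomp (h i) (near_id (fun i => nr i (y i))) -
              \sum_k res k (y k) * fderiv k (nr i (y i)).
have n2 y : (forall i, ord_ge 2 (y i)) -> forall i, ord_ge 2 (nr i (y i)).
  by move=> y2 i; apply: ord_ge_mult.
have n1 y : (forall i, ord_ge 2 (y i)) -> forall i, ord_ge 1 (near_id (fun i => nr i (y i)) i).
  by move=> y2; apply: near_id1; exact: n2.
have [|n y z y2 z2 yz i|y y2 ey] := @fixed_point K (fun y i => L i (F y i)).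
- move=> y y2 i; apply: ord_ge_mult; apply: ord_geB; first exact: ord_ge_comp.
  by apply: ord_ge_sum => k _; apply/ord_geMl/ord_ge_mult.
- rewrite -fmultB; apply: ord_ge_mult; rewrite /F.
  set A := fcomp _ _; set B := \sum_k _; set C := fcomp _ _; set D := \sum_k _.
  have -> : A - B - (C - D) = (A - C) - (B - D) by ring.
  apply: ord_geB.
    apply: ord_ge_compB => //; [exact: n1|exact: n1|move=> j].
    by rewrite near_idB -fmultB; apply: ord_ge_mult.
  rewrite -sumrB; apply: ord_ge_sum => k _.
  have -> : res k (y k) * fderiv k (nr i (y i)) - res k (z k) * fderiv k (nr i (z i)) =
     res k (y k - z k) * fderiv k (nr i (y i)) + res k (z k) * fderiv k (nr i (y i - z i)).
    by rewrite /res /nr !fmultB fderivB; ring.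
  apply: ord_geD.
    rewrite -[n.+3]addn1; apply: ord_geM; first exact: ord_ge_mult.
    by apply/ord_ge_deriv/ord_ge_mult.
  rewrite -[n.+3]/(2 + n.+1)%N; apply: ord_geM; first exact: ord_ge_mult.
  by apply/ord_ge_deriv/ord_ge_mult.
exists (fun i => nr i (y i)), (fun i => res i (y i)); split.
- by split => i; apply: ord_ge_mult.
- by move=> i m /= ->; rewrite eqxx mul0r.
- move=> i m; have [//|ne] := eqVneq (wt m) (lam i).
  by rewrite /= (negbTE ne) mul0r eqxx.
move=> i; rewrite lie_addvf lie_diag /addvf fcompD fcompM ?fcomp_const ?fcompX; try exact: n1.
have yE : F y i = nr i (fmult wt (y i)) - fconst (lam i) * nr i (y i) + res i (y i).
  apply/fserP => m; rewrite fcoefD fcoefB fcoefCM /= -[in RHS]ey /=.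
  case: eqP => [_|ne] /=; rewrite ?mulr0n ?mulr1n; first by ring.
  have u : wt m - lam i != 0 by rewrite subr_eq0; apply/eqP.
  by rewrite mul0r !mul1r addr0 -mulrBl mulrA mulfV // mul1r.
have -> : fcomp (h i) (near_id (fun i => nr i (y i))) =
  F y i + \sum_k res k (y k) * fderiv k (nr i (y i)) by rewrite /F subrK.
rewrite yE /near_id fmultD.
have -> : fmult wt (fX K i) = fconst (lam i) * fX K i.
  apply/fserP => m; rewrite fcoefCM /=; case: eqP => [->|_]; last by rewrite !mulr0.
  by rewrite wt_unit.
have -> : fmult wt (nr i (y i)) = nr i (fmult wt (y i)).
  by apply/fserP => m /=; rewrite mulrCA.
have -> : lie (fun i => res i (y i)) (fX K i + nr i (y i)) =
   res i (y i) + \sum_k res k (y k) * fderiv k (nr i (y i)).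
  by rewrite lieD lieX.
by ring.
Qed.

(** Each N_i d/dx_i preserves weights, since N_i has weight lam_i; hence it
    commutes with every function of S. *)
Lemma lie_resonant N (f : K -> K) a : (forall i m, N i m != 0 -> wt m = lam i) ->
  fmult (fun m => f (wt m)) (lie N a) = lie N (fmult (fun m => f (wt m)) a).
Proof.
move=> hN; apply/fserP => m; rewrite /lie /= !fcoef_sum mulr_sumr.
apply: eq_bigr => i _; rewrite !(@fcoefM _ (mdeg m).+1) // mulr_sumr.
apply: eq_bigr => p _; rewrite mulr_sumr; apply: eq_bigr => q /eqP <-.
have [->|np] := eqVneq (N i p) 0; first by rewrite !mul0r mulr0.
rewrite !fderivE /= !wtD wt_unit (hN _ _ np) addrC; ring.
Qed.

(** On the components of nonzero weight S is invertible, while N raises the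
    order: a first integral has no such component, because its lowest part
    would be killed by S. *)
Lemma integral_resonant N a : (forall i, ord_ge 2 (N i)) ->
  (forall i m, N i m != 0 -> wt m = lam i) ->
  lie (addvf diag_vf N) a = 0 -> fmult wt a = 0 /\ lie N a = 0.
Proof.
move=> N2 hN; rewrite lie_addvf lie_diag => h.
pose nr := fmult (fun m => (wt m != 0)%:R : K).
have hnr : fmult wt (nr a) + lie N (nr a) = 0.
  rewrite -(@lie_resonant _ (fun x => (x != 0)%:R)) //.
  have -> : fmult wt (nr a) = nr (fmult wt a) by apply/fserP => m /=; rewrite mulrCA.
  by rewrite -fmultD h; apply/fserP => m /=; rewrite mulr0.
have nr0 : nr a = 0.
  apply: ord_ge_eq0; elim=> [//|n IH m hm].
  have [w0|w0] := eqVneq (wt m) 0; first by rewrite /= w0 eqxx mul0r.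
  have : lie N (nr a) m = 0.
    suff: ord_ge n.+1 (lie N (nr a)) by apply.
    apply: ord_ge_sum => i _; apply: (@ord_geW _ _ (2 + n.-1)%N); first by lia.
    apply: ord_geM => //; case: n IH {hm} => // n IH; exact: ord_ge_deriv.
  move/fserP: hnr => /(_ m); rewrite fcoefD => + e; rewrite e addr0 /= => /eqP.
  by rewrite mulf_eq0 (negbTE w0) => /eqP.
have e : fmult wt a = 0.
  apply/fserP => m /=; have [->|w0] := eqVneq (wt m) 0; first by rewrite mul0r.
  by move/fserP: nr0 => /(_ m) /=; rewrite w0 mul1r => ->; rewrite mulr0.
by split => //; move: h; rewrite e add0r.
Qed.

End NormalForm.

(** * Integrability and resonances *)

Section Integrability.
Variable K : numFieldType.
Variable lam : 'I_3 -> K.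
Hypothesis lam_neq0 : forall i, lam i != 0.
Implicit Types (a b c : fser K) (Phi Psi y z N : 'I_3 -> fser K).
Implicit Types m p q : mon3.
Notation W := (wt lam).
Notation S := (diag_vf lam).

Definition indep_mon p q := exists i j, (p i * q j)%N <> (p j * q i)%N.

(** The coefficients of x_i x_j (da /\ db)_ij are sums of the numbers
    (p_i q_j - p_j q_i) a_p b_q. *)
Lemma wedge_supp_indep a b i j : fwedge a b i j != 0 ->
  exists p q, [/\ a p != 0, b q != 0 & indep_mon p q].
Proof.
apply: contra_neqP => h; have hpq p q : a p * b q != 0 -> (p i * q j = p j * q i)%N.
  rewrite mulf_eq0 negb_or => /andP[ap bq].
  by apply: contrapT => ne; apply: h; exists p, q; split => //; exists i, j.
suff: fwedge a b i j * (fX K i * fX K j) = 0.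
  case/fmul_eq0 => // /fmul_eq0[] /eqP; by rewrite (negbTE (fX_neq0 _ _)).
have -> : fwedge a b i j * (fX K i * fX K j) =
    fmult (fun m => (m i)%:R) a * fmult (fun m => (m j)%:R) b -
    fmult (fun m => (m j)%:R) a * fmult (fun m => (m i)%:R) b.
  by rewrite -!mulX_deriv /fwedge; ring.
apply/fserP => m; rewrite fcoefB !(@fcoefM _ (mdeg m).+1) // -sumrB big1 // => p _.
rewrite -sumrB big1 // => q _ /=.
rewrite mulrACA [X in _ - X]mulrACA.
have [e|ne] := eqVneq (a p * b q) 0; first by rewrite e !mulr0 subrr.
by rewrite -!natrM (hpq _ _ ne) subrr.
Qed.

(** A vector (x, y, z) orthogonal to p and q is proportional to their cross
    product; here the proportionality is paired with an arbitrary vector n and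
    freed of denominators. *)
Lemma cross_identity (x y z p1 p2 p3 q1 q2 q3 n1 n2 n3 : K) :
  x * p1 + y * p2 + z * p3 = 0 -> x * q1 + y * q2 + z * q3 = 0 ->
  (p1 * q2 - p2 * q1) * (x * n1 + y * n2 + z * n3) =
  z * ((p2 * q3 - p3 * q2) * n1 + (p3 * q1 - p1 * q3) * n2 + (p1 * q2 - p2 * q1) * n3).
Proof.
move=> e1 e2; apply/eqP; rewrite -subr_eq0; apply/eqP.
transitivity ((x * p1 + y * p2 + z * p3) * (q2 * n1 - q1 * n2) -
  (x * q1 + y * q2 + z * q3) * (p2 * n1 - p1 * n2)); first by ring.
by rewrite e1 e2 !mul0r subrr.
Qed.

(** Up to the factor lam_k / D, where D is a nonzero minor of (p, q), every
    weight is an integer, and so is every difference of weights: one can take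
    c = |lam_k / D|. *)
Lemma weights_discrete p q : W p = 0 -> W q = 0 -> indep_mon p q ->
  exists2 c : K, 0 < c & forall m i, W m != lam i -> c <= `|W m - lam i|.
Proof.
move=> wp wq [i0 [j0 ne]].
have [k [D [D0 hD]]] : exists k (D : int), D != 0 /\ forall n : 'I_3 -> int,
    exists t : int, D%:~R * (\sum_i lam i * (n i)%:~R) = lam k * t%:~R.
  have det_neq0 (i j : 'I_3) : (p i * q j)%N <> (p j * q i)%N ->
      (p i)%:Z * (q j)%:Z - (p j)%:Z * (q i)%:Z != 0.
    by move=> h; rewrite subr_eq0 -!PoszM; apply/eqP => -[].
  have e (n : 'I_3 -> int) : \sum_i lam i * (n i)%:~R =
     lam o0 * (n o0)%:~R + lam o1 * (n o1)%:~R + lam o2 * (n o2)%:~R.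
    rewrite !big_ord_recl big_ord0 addr0 addrA.
    by congr (_ + _ + _); congr (lam _ * (n _)%:~R); apply: val_inj.
  have ep : lam o0 * (p o0)%:~R + lam o1 * (p o1)%:~R + lam o2 * (p o2)%:~R = 0.
    by rewrite -(e (fun i => p i)) -[RHS]wp /wt; apply: eq_bigr => i _; rewrite -pmulrn.
  have eq : lam o0 * (q o0)%:~R + lam o1 * (q o1)%:~R + lam o2 * (q o2)%:~R = 0.
    by rewrite -(e (fun i => q i)) -[RHS]wq /wt; apply: eq_bigr => i _; rewrite -pmulrn.
  have h01 : (p o0 * q o1)%N <> (p o1 * q o0)%N -> exists k (D : int), D != 0 /\
     forall n : 'I_3 -> int, exists t : int,
       D%:~R * (\sum_i lam i * (n i)%:~R) = lam k * t%:~R.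
    move=> /det_neq0 D0; exists o2, ((p o0)%:Z * (q o1)%:Z - (p o1)%:Z * (q o0)%:Z).
    split => // n; rewrite e; eexists.
    by rewrite rmorphB !rmorphM /= (cross_identity _ _ _ ep eq) -!rmorphM -!rmorphB
       -!rmorphM -!rmorphD.
  have h02 : (p o0 * q o2)%N <> (p o2 * q o0)%N -> exists k (D : int), D != 0 /\
     forall n : 'I_3 -> int, exists t : int,
       D%:~R * (\sum_i lam i * (n i)%:~R) = lam k * t%:~R.
    move=> /det_neq0 D0; exists o1, ((p o0)%:Z * (q o2)%:Z - (p o2)%:Z * (q o0)%:Z).
    split => // n; rewrite e addrAC; eexists; rewrite addrAC in ep; rewrite addrAC in eq.
    by rewrite rmorphB !rmorphM /= (cross_identity _ _ _ ep eq) -!rmorphM -!rmorphB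
       -!rmorphM -!rmorphD.
  have h12 : (p o1 * q o2)%N <> (p o2 * q o1)%N -> exists k (D : int), D != 0 /\
     forall n : 'I_3 -> int, exists t : int,
       D%:~R * (\sum_i lam i * (n i)%:~R) = lam k * t%:~R.
    move=> /det_neq0 D0; exists o0, ((p o1)%:Z * (q o2)%:Z - (p o2)%:Z * (q o1)%:Z).
    split => // n; rewrite e -addrA addrC; eexists.
    rewrite -addrA addrC in ep; rewrite -addrA addrC in eq.
    by rewrite rmorphB !rmorphM /= (cross_identity _ _ _ ep eq) -!rmorphM -!rmorphB
       -!rmorphM -!rmorphD.
  have sy (i j : 'I_3) : (p j * q i)%N <> (p i * q j)%N -> (p i * q j)%N <> (p j * q i)%N.
    by move=> h /esym.
  by case: (ord3P i0) ne => ->; case: (ord3P j0) => -> ne;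
     first [by case: ne | exact: h01 | exact: h02 | exact: h12
           | exact: h01 (sy _ _ ne) | exact: h02 (sy _ _ ne) | exact: h12 (sy _ _ ne)].
have D0' : (0 : K) < `|D%:~R| by rewrite normr_gt0 intr_eq0.
exists (`|lam k| / `|D%:~R|); first by rewrite divr_gt0 // normr_gt0.
move=> m i nl; have [t ht] := hD (fun j => (m j)%:Z - (j == i)%:Z).
have E : \sum_j lam j * ((m j)%:Z - (j == i)%:Z)%:~R = W m - lam i.
  under eq_bigr do rewrite rmorphB mulrBr.
  rewrite big_split /= sumrN; congr (_ - _).
  rewrite (bigD1 i) //= eqxx mulr1 big1 ?addr0 // => j /negbTE ->.
  by rewrite mulr0.
rewrite E in ht; rewrite ler_pdivrMr // mulrC -normrM ht normrM.
rewrite ler_peMr // -intr_norm -[1]/(1%:~R) ler_int.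
have : t != 0.
  apply: contra_neq nl => t0; move: ht; rewrite t0 mulr0 => /eqP.
  by rewrite mulf_eq0 intr_eq0 (negbTE D0) subr_eq0 => /eqP.
by rewrite -normr_gt0 -gtz0_ge1.
Qed.

(** Both fields are orthogonal to da and db, hence proportional to the cross
    product w of these two covectors, which is nonzero. *)
Lemma parallel_of_integrals Y N a b (i j : 'I_3) :
  lie Y a = 0 -> lie Y b = 0 -> lie N a = 0 -> lie N b = 0 ->
  (exists k l, fwedge a b k l != 0) -> Y i * N j = Y j * N i.
Proof.
move=> Ya Yb Na Nb [k [l w0]].
pose w := fun i : 'I_3 => if i == o0 then fwedge a b o1 o2 else
  if i == o1 then fwedge a b o2 o0 else fwedge a b o0 o1.
have e3 Z c : lie Z c = Z o0 * fderiv o0 c + Z o1 * fderiv o1 c + Z o2 * fderiv o2 c.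
  rewrite /lie !big_ord_recl big_ord0 addr0 addrA.
  by congr (_ + _ + _); congr (Z _ * fderiv _ c); apply: val_inj.
have par Z : lie Z a = 0 -> lie Z b = 0 -> forall s t, Z s * w t = Z t * w s.
  move=> za zb.
  have id1 : Z o0 * w o1 = Z o1 * w o0.
    apply/eqP; rewrite -subr_eq0; apply/eqP; rewrite /w /= /fwedge.
    transitivity (fderiv o2 a * lie Z b - fderiv o2 b * lie Z a); first by rewrite !e3; ring.
    by rewrite za zb !mulr0 subrr.
  have id2 : Z o0 * w o2 = Z o2 * w o0.
    apply/eqP; rewrite -subr_eq0; apply/eqP; rewrite /w /= /fwedge.
    transitivity (fderiv o1 b * lie Z a - fderiv o1 a * lie Z b); first by rewrite !e3; ring.
    by rewrite za zb !mulr0 subrr.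
  have id3 : Z o1 * w o2 = Z o2 * w o1.
    apply/eqP; rewrite -subr_eq0; apply/eqP; rewrite /w /= /fwedge.
    transitivity (fderiv o0 a * lie Z b - fderiv o0 b * lie Z a); first by rewrite !e3; ring.
    by rewrite za zb !mulr0 subrr.
  by move=> s t; case: (ord3P s) => ->; case: (ord3P t) => ->.
have [t wt0] : exists t, w t != 0.
  have anti (x y : 'I_3) : fwedge a b x y = - fwedge a b y x by rewrite /fwedge; ring.
  have nn (x y : 'I_3) : fwedge a b x y != 0 -> fwedge a b y x != 0.
    by rewrite anti oppr_eq0.
  have diag (x : 'I_3) : fwedge a b x x != 0 -> False by rewrite /fwedge subrr eqxx.
  by case: (ord3P k) w0 => ->; case: (ord3P l) => -> w0;
     first [by case: (diag _ w0) | by exists o0 | by exists o1 | by exists o2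
           | by exists o0; exact: nn | by exists o1; exact: nn | by exists o2; exact: nn].
have : (Y i * N j - Y j * N i) * (w t * w t) = 0.
  have -> : (Y i * N j - Y j * N i) * (w t * w t) =
    (Y i * w t) * (N j * w t) - (Y j * w t) * (N i * w t) by ring.
  by rewrite (par _ Ya Yb i t) (par _ Ya Yb j t) (par _ Na Nb i t) (par _ Na Nb j t); ring.
case/fmul_eq0 => [/eqP|]; first by rewrite subr_eq0 => /eqP.
by case/fmul_eq0 => /eqP; rewrite (negbTE wt0).
Qed.

(** The relation lam_i x_i N_j = lam_j x_j N_i shows that x_i divides N_i, with a
    quotient that does not depend on i up to the factor lam_i. *)
Lemma resonant_multiple N : (forall i, ord_ge 2 (N i)) ->
  (forall i m, N i m != 0 -> W m = lam i) ->
  (forall i j, S i * N j = S j * N i) ->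
  exists g : fser K, [/\ ord_ge 1 g, forall m, g m != 0 -> W m = 0 &
    forall i, N i = g * S i].
Proof.
move=> N2 hN par; pose g := Fser (fun m => N o0 (madd m (munit o0)) / lam o0).
have N0E : N o0 = g * S o0.
  apply/fserP => m; rewrite /diag_vf mulrCA fcoefCM.
  case: (posnP (m o0)) => h; last first.
    have -> : m = madd (msub m (munit o0)) (munit o0).
      by apply/ffunP => j; rewrite !ffunE subnK //; case: eqP => // ->.
    by rewrite fcoef_mulmon /= mulrC divfK.
  rewrite fcoef_mulmon0 ?mulr0; last by exists o0; rewrite ffunE eqxx h.
  move/fserP: (par o0 o1) => /(_ (madd m (munit o1))).
  rewrite /diag_vf -!mulrA !fcoefCM [fX K o1 * _]mulrC fcoef_mulmon.
  rewrite [fX K o0 * _]mulrC fcoef_mulmon0 ?mulr0; last first.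
    by exists o0; rewrite !ffunE h eqxx.
  by move/esym/eqP; rewrite mulf_eq0 (negbTE (lam_neq0 _)) => /eqP.
exists g; split.
- by move=> m hm /=; rewrite N2 ?mul0r // mdegD mdeg_unit; lia.
- move=> m; rewrite /= mulf_eq0 negb_or => /andP[/hN + _].
  by rewrite wtD wt_unit => /eqP; rewrite -subr_eq0 addrK => /eqP.
move=> i; have /eqP := par o0 i; rewrite N0E.
rewrite -subr_eq0 (_ : _ - _ = S o0 * (N i - g * S i)); last by ring.
move=> /eqP /fmul_eq0[|/eqP]; last by rewrite subr_eq0 => /eqP.
move/fserP => /(_ (munit o0)); rewrite /diag_vf fcoefCM /= eqxx mulr1 => /eqP.
by rewrite (negbTE (lam_neq0 _)).
Qed.

End Integrability.

Section Linearization.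
Variable K : numFieldType.
Variable lam : 'I_3 -> K.
Hypothesis lam_neq0 : forall i, lam i != 0.
Variable h : 'I_3 -> fser K.
Hypothesis h2 : forall i, ord_ge 2 (h i).
Notation W := (wt lam).
Notation S := (diag_vf lam).
Notation X := (addvf S h).
Variables F1 F2 : fser K.
Hypotheses (XF1 : lie X F1 = 0) (XF2 : lie X F2 = 0).
Hypothesis F12 : exists i j, fwedge F1 F2 i j != 0.
Implicit Types m p q : mon3.

(** The equation of the normal form is read at an exponent of weight w.  If
    w = lam_i it determines the coefficient of g x_i = N_i / lam_i; otherwise it
    determines that of phi_i, and there the derivative S (g phi_i) is harmless,
    since w / (w - lam_i) is bounded by 1 + |lam_i| / c. *)
Lemma formal_linearization : exists (phi : 'I_3 -> fser K) (g : fser K) (p q : mon3),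
  [/\ (forall i, ord_ge 2 (phi i)) /\ ord_ge 1 g,
      [/\ W p = 0, W q = 0 & indep_mon p q],
      frelated (fun i => (1 + g) * S i) X (near_id phi) &
      exists2 C : K, 0 <= C & forall i m,
        `|(g * fX K i) m| <= C * `|fcomp (h i) (near_id phi) m| /\
        `|phi i m| <= C * (`|fcomp (h i) (near_id phi) m| + `|(g * phi i) m|)].
Proof.
have [phi [N [[p2 N2] pnr Nr rel]]] := formal_normal_form lam h2.
have p1 := near_id1 p2.
have [psi [s2 _ sp _]] := near_id_inverse p2; have s1 := near_id1 s2.
pose G F := fcomp F (near_id phi).
have ZG F : lie X F = 0 -> lie (addvf S N) (G F) = 0.
  by move=> e; rewrite (lie_related _ p1 rel) e fcomp0.
have [S1 N1] := integral_resonant N2 Nr (ZG _ XF1).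
have [S2 N2'] := integral_resonant N2 Nr (ZG _ XF2).
have G12 := fwedge_comp_neq0 p1 s1 sp F12.
have [p [q [Gp Gq pq]]] : exists p q, [/\ G F1 p != 0, G F2 q != 0 & indep_mon p q].
  by case: G12 => i [j]; exact: wedge_supp_indep.
have res F m : fmult W F = 0 -> F m != 0 -> W m = 0.
  by move=> /fserP /(_ m) /eqP /=; rewrite mulf_eq0 => /orP[/eqP //|/eqP ->]; rewrite eqxx.
have wp := res _ _ S1 Gp; have wq := res _ _ S2 Gq.
have [g [g1 gr NE]] := resonant_multiple lam_neq0 N2 Nr
  (fun i j => parallel_of_integrals i j (etrans (lie_diag lam _) S1)
     (etrans (lie_diag lam _) S2) N1 N2' G12).
have [c c0 hc] := weights_discrete lam_neq0 wp wq pq.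
exists phi, g, p, q; split => //.
  have -> : (fun i => (1 + g) * S i) = addvf S N; last by [].
  by apply: funext => i; rewrite /addvf NE; ring.
(* The relation Z (x_i + phi_i) = X_i o Phi, where N phi_i = g S phi_i = S (g phi_i). *)
have eqn i m : N i m + W m * phi i m + W m * (g * phi i) m =
    lam i * phi i m + fcomp (h i) (near_id phi) m.
  have := rel i; rewrite lie_addvf lie_diag /addvf fcompD fcompM // fcomp_const // fcompX //.
  rewrite {1 2 3}/near_id lieD lieX fmultD.
  have -> : lie N (phi i) = fmult W (g * phi i).
    have -> : lie N (phi i) = g * fmult W (phi i).
      by rewrite -lie_diag /lie mulr_sumr; apply: eq_bigr => k _; rewrite NE mulrA.
    apply/fserP => k /=; rewrite !(@fcoefM _ (mdeg k).+1) // mulr_sumr.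
    apply: eq_bigr => r _; rewrite mulr_sumr; apply: eq_bigr => s /eqP <- /=.
    have [->|gr0] := eqVneq (g r) 0; first by rewrite !mul0r mulr0.
    by rewrite wtD (gr _ gr0) add0r mulrCA.
  have -> : fmult W (fX K i) = S i.
    by rewrite -lie_diag lieX.
  rewrite /diag_vf mulrDr => e; have {}e : N i + fmult W (phi i) + fmult W (g * phi i) =
    fconst (lam i) * phi i + fcomp (h i) (near_id phi).
    apply: (@addrI _ (fconst (lam i) * fX K i)); rewrite [RHS]addrA -e; ring.
  by move/fserP: e => /(_ m); rewrite !fcoefD fcoefCM.
have gphi i m : W m = lam i -> (g * phi i) m = 0.
  move=> wm; rewrite (@fcoefM _ (mdeg m).+1) // big1 // => r _.
  rewrite big1 // => s /eqP E.
  have [->|gr0] := eqVneq (g r) 0; first by rewrite mul0r.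
  by rewrite pnr ?mulr0 // -wm -E wtD (gr _ gr0) add0r.
(* Large enough for both quotients: w / (w - lam_i) = 1 + lam_i / (w - lam_i). *)
pose C : K := 1 + \sum_i (`|lam i|^-1 + c^-1 * (1 + `|lam i|)).
have term_ge0 i : 0 <= `|lam i|^-1 + c^-1 * (1 + `|lam i|).
  by rewrite addr_ge0 ?invr_ge0 // mulr_ge0 ?addr_ge0 // invr_ge0 ltW.
have C1 : 1 <= C by rewrite lerDl sumr_ge0.
have C0 : 0 <= C by exact: le_trans C1.
have CS i : `|lam i|^-1 + c^-1 * (1 + `|lam i|) <= \sum_i (`|lam i|^-1 + c^-1 * (1 + `|lam i|)).
  by rewrite (bigD1 i) //= lerDl sumr_ge0.
exists C => // i m.
have := eqn i m; have [wm|wm] := eqVneq (W m) (lam i).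
  rewrite wm gphi // pnr // !mulr0 !addr0 add0r NE /diag_vf mulrCA fcoefCM => <-.
  rewrite normr0; split; last by rewrite mulr_ge0 // addr_ge0.
  rewrite normrM mulrA -[leLHS]mul1r ler_wpM2r // -(@ler_pdivrMr _ `|lam i|) ?normr_gt0 //.
  rewrite mul1r; apply: le_trans (ler_wpDl ler01 (le_trans _ (CS i))) => //.
  by rewrite lerDl mulr_ge0 ?addr_ge0 // invr_ge0 ltW.
have Nm : N i m = 0 by apply/eqP; apply: contraT => /Nr /eqP; rewrite (negbTE wm).
have -> : (g * fX K i) m = 0.
  by move: Nm; rewrite NE /diag_vf mulrCA fcoefCM => /eqP; rewrite mulf_eq0
    (negbTE (lam_neq0 i)) => /eqP.
rewrite Nm add0r normr0 => e; split; first by rewrite mulr_ge0.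
set H := fcomp (h i) (near_id phi) m in e *; set P := (g * phi i) m in e *.
have {}e : (W m - lam i) * phi i m = H - W m * P.
  by apply/eqP; rewrite mulrBl subr_eq addrAC -subr_eq opprK [H + _]addrC; apply/eqP.
have d0 : W m - lam i != 0 by rewrite subr_eq0.
have -> : phi i m = (W m - lam i)^-1 * H - (1 + lam i / (W m - lam i)) * P.
  apply: (mulfI d0); rewrite e; field; exact: d0.
have dc : `|(W m - lam i)^-1| <= c^-1.
  by rewrite normfV lef_pV2 ?posrE ?normr_gt0 //; exact: hc.
have Cc : c^-1 <= C.
  apply: le_trans (ler_wpDl ler01 (le_trans _ (CS i))) => //.
  rewrite mulrDr mulr1 addrCA lerDl addr_ge0 ?invr_ge0 // mulr_ge0 // invr_ge0 ltW //.
apply: le_trans (ler_normB _ _) _; rewrite mulrDr !normrM; apply: lerD.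
  by rewrite ler_wpM2r //; exact: le_trans dc Cc.
rewrite ler_wpM2r //; apply: le_trans (ler_normD _ _) _; rewrite normr1 lerD2l.
rewrite normrM mulrC; apply: le_trans (CS i).
apply: (@le_trans _ _ (c^-1 * `|lam i|)); first by rewrite ler_wpM2r.
rewrite mulrDr addrA lerDr addr_ge0 ?invr_ge0 // mulr1 invr_ge0 ltW //.
Qed.

End Linearization.

Lemma resonant_monomial_integral (K : numFieldType) (lam : 'I_3 -> K) (g : fser K) p :
  wt lam p = 0 -> lie (fun i => (1 + g) * diag_vf lam i) (fmon K p) = 0.
Proof.
move=> wp; transitivity ((1 + g) * lie (diag_vf lam) (fmon K p)).
  by rewrite /lie mulr_sumr; apply: eq_bigr => i _; rewrite mulrA.
rewrite lie_diag (_ : fmult _ _ = 0) ?mulr0 //; apply/fserP => m /=.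
by case: eqP => [->|_]; rewrite ?wp ?mul0r ?mulr0.
Qed.

Lemma wedge_mon_neq0 (K : numFieldType) p q : indep_mon p q ->
  exists i j, fwedge (fmon K p) (fmon K q) i j != 0.
Proof.
move=> [i [j ne]]; exists i, j; apply/eqP => w0.
have : fwedge (fmon K p) (fmon K q) i j * (fX K i * fX K j) = 0 by rewrite w0 mul0r.
have tm l r : fmult (fun m => (m l)%:R) (fmon K r) = fconst (r l)%:R * fmon K r.
  by apply/fserP => m; rewrite fcoefCM /=; case: eqP => [->|_]; rewrite ?mulr0.
have -> : fwedge (fmon K p) (fmon K q) i j * (fX K i * fX K j) =
   fconst ((p i)%:R * (q j)%:R - (p j)%:R * (q i)%:R) * fmon K (madd p q).
  transitivity (fmult (fun m => (m i)%:R) (fmon K p) * fmult (fun m => (m j)%:R) (fmon K q) -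
    fmult (fun m => (m j)%:R) (fmon K p) * fmult (fun m => (m i)%:R) (fmon K q)).
    by rewrite -!mulX_deriv /fwedge; ring.
  by rewrite !tm fmonD rmorphB !rmorphM /=; ring.
move/fserP => /(_ (madd p q)); rewrite fcoefCM /= eqxx mulr1 => /eqP.
by rewrite subr_eq0 -!natrM eqr_nat => /eqP.
Qed.

(** * Truncated norms *)

Lemma sum_mons_shift (V : zmodType) N i (F : mon3 -> V) :
  \sum_(m <- mons N) F (madd m (munit i)) = \sum_(m <- mons N.+1 | (0 < m i)%N) F m.
Proof.
rewrite -(big_map (fun m => madd m (munit i)) predT) -[RHS]big_filter.
apply: perm_big; apply: uniq_perm.
- rewrite map_inj_uniq ?mons_uniq // => p q /eqP; rewrite maddIr => /eqP //.
- exact/filter_uniq/mons_uniq.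
move=> m; rewrite mem_filter mem_mons; apply/mapP/andP => [[p] |[mi hm]].
  rewrite mem_mons => hp ->; rewrite ffunE mdegD mdeg_unit addn1 ltnS.
  by rewrite ffunE eqxx addn1.
have e : m = madd (msub m (munit i)) (munit i).
  by apply/ffunP => j; rewrite !ffunE subnK //; case: eqP => // ->.
exists (msub m (munit i)) => //; rewrite mem_mons.
by move: hm; rewrite {1}e mdegD mdeg_unit addn1 ltnS.
Qed.

Section Norm.
Variable K : numFieldType.
Implicit Types (a b c : fser K) (Phi Psi y : 'I_3 -> fser K) (r s t : K).
Implicit Types m p q : mon3.

(** The weighted l1-norm of the part of degree < N. *)
Definition nrm r N a : K := \sum_(m <- mons N) `|a m| * r ^+ mdeg m.

Lemma nrm_ge0 r N a : 0 <= r -> 0 <= nrm r N a.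
Proof. by move=> r0; apply: sumr_ge0 => m _; rewrite mulr_ge0 ?exprn_ge0. Qed.

Lemma nrm_widen r N N' a : (N <= N')%N ->
  nrm r N a = \sum_(m <- mons N' | (mdeg m < N)%N) `|a m| * r ^+ mdeg m.
Proof.
move=> h; rewrite (@sum_mons_widen _ N N') //; last by move=> p; rewrite ltnNge => /negbTE ->.
rewrite /nrm big_seq [RHS]big_seq_cond; apply: eq_bigl => m.
by rewrite mem_mons andbb.
Qed.

Lemma ler_nrm_N r N N' a : 0 <= r -> (N <= N')%N -> nrm r N a <= nrm r N' a.
Proof.
move=> r0 h; rewrite (nrm_widen _ _ h) /nrm big_mkcond; apply: ler_sum => m _.
by case: ifP => // _; rewrite mulr_ge0 ?exprn_ge0.
Qed.

Lemma ler_nrm_r r s N a : 0 <= r -> r <= s -> nrm r N a <= nrm s N a.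
Proof.
move=> r0 rs; apply: ler_sum => m _; rewrite ler_wpM2l //.
by rewrite lerXn2r ?nnegrE //; exact: le_trans rs.
Qed.

Lemma nrm_congr r N a b : ord_ge N (a - b) -> nrm r N a = nrm r N b.
Proof.
move=> h; rewrite /nrm big_seq [RHS]big_seq; apply: eq_bigr => m.
rewrite mem_mons => /h /eqP; rewrite fcoefB subr_eq0 => /eqP -> //.
Qed.

Lemma nrm0 r N : nrm r N 0 = 0.
Proof. by rewrite /nrm big1 // => m _; rewrite fcoef0 normr0 mul0r. Qed.

Lemma nrmN r N a : nrm r N (- a) = nrm r N a.
Proof. by apply: eq_bigr => m _; rewrite fcoefN normrN. Qed.

Lemma ler_nrmD r N a b : 0 <= r -> nrm r N (a + b) <= nrm r N a + nrm r N b.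
Proof.
move=> r0; rewrite /nrm -big_split; apply: ler_sum => m _ /=.
by rewrite -mulrDl ler_wpM2r ?exprn_ge0 // ler_normD.
Qed.

Lemma ler_nrm_comb r N a b c (C : K) : 0 <= r ->
  (forall m, `|a m| <= C * (`|b m| + `|c m|)) ->
  nrm r N a <= C * (nrm r N b + nrm r N c).
Proof.
move=> r0 h; rewrite /nrm -big_split mulr_sumr; apply: ler_sum => m _ /=.
by rewrite -mulrDl mulrA ler_wpM2r ?exprn_ge0.
Qed.

Lemma ler_nrmM r N a b : 0 <= r -> nrm r N (a * b) <= nrm r N a * nrm r N b.
Proof.
move=> r0; pose G p q := (`|a p| * r ^+ mdeg p) * (`|b q| * r ^+ mdeg q).
have G0 p q : 0 <= G p q by apply: mulr_ge0; rewrite mulr_ge0 ?exprn_ge0.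
apply: (@le_trans _ _ (\sum_(m <- mons N) \sum_(p <- mons N) \sum_(q <- mons N)
    if madd p q == m then G p q else 0)).
  rewrite /nrm big_seq [leRHS]big_seq; apply: ler_sum => m; rewrite mem_mons => mN.
  rewrite (fcoefM _ _ mN); apply: le_trans (ler_wpM2r _ (ler_norm_sum _ _ _)) _.
    exact: exprn_ge0.
  rewrite mulr_suml; apply: ler_sum => p _.
  apply: le_trans (ler_wpM2r _ (ler_norm_sum _ _ _)) _; first exact: exprn_ge0.
  rewrite mulr_suml big_mkcond; apply: ler_sum => q _; case: eqP => // <-.
  by rewrite normrM mdegD exprD /G mulrACA.
rewrite /nrm mulr_suml exchange_big; apply: ler_sum => p _ /=.
rewrite mulr_sumr exchange_big; apply: ler_sum => q _ /=; rewrite -big_mkcond /=.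
case: (ltnP (mdeg (madd p q)) N) => h.
  by under eq_bigl do rewrite eq_sym; rewrite sum_mons1.
rewrite big_seq_cond big1; first exact: G0.
move=> m /andP[]; rewrite mem_mons => hm /eqP e.
by move: h; rewrite e leqNgt hm.
Qed.

Lemma nrm_trunc r N N' a : (N <= N')%N -> nrm r N' (ftrunc N a) = nrm r N a.
Proof.
move=> h; rewrite (nrm_widen _ _ h) /nrm [RHS]big_mkcond; apply: eq_bigr => m _ /=.
by case: ifP => // _; rewrite normr0 mul0r.
Qed.

Lemma ord_ge_ftrunc n N a : ord_ge n a -> ord_ge n (ftrunc N a).
Proof. by move=> h m hm /=; rewrite h // if_same. Qed.

(** Without constant terms, the terms of degree N of a product involve only
    terms of degree < N of the factors.  This gain of one degree is what
    makes estimates by induction on the degree possible. *)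
Lemma ler_nrmM_shift r N a b : 0 <= r -> ord_ge 1 a -> ord_ge 1 b ->
  nrm r N.+1 (a * b) <= nrm r N a * nrm r N b.
Proof.
move=> r0 a1 b1; rewrite (@nrm_congr _ _ _ (ftrunc N a * ftrunc N b)); last first.
  have -> : a * b - ftrunc N a * ftrunc N b =
     (a - ftrunc N a) * b + ftrunc N a * (b - ftrunc N b) by ring.
  apply: ord_geD.
    by rewrite -addn1; apply: ord_geM => //; exact: ord_ge_trunc.
  by rewrite -add1n; apply: ord_geM; [exact: ord_ge_ftrunc | exact: ord_ge_trunc].
by apply: le_trans (ler_nrmM _ _ _ r0) _; rewrite !nrm_trunc.
Qed.

Lemma ler_nrm1 r N : nrm r N 1 <= 1.
Proof.
case: N => [|N]; first by rewrite /nrm big_seq big1 // => m; rewrite mem_mons.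
rewrite /nrm (bigID (pred1 mzero)) /= sum_mons1 ?mdeg0 //= eqxx normr1 mul1r.
by rewrite big1 ?addr0 // => p /negbTE h; rewrite h normr0 mul0r.
Qed.

Lemma ler_nrm_powm r s N Phi m : 0 <= r -> 0 <= s ->
  (forall i, nrm r N (Phi i) <= s) -> nrm r N (powm Phi m) <= s ^+ mdeg m.
Proof.
move=> r0 s0 h; elim/mon_ind: m => [|m i IH].
  by rewrite powm0 mdeg0; exact: ler_nrm1.
rewrite powmD powm_munit mdegD mdeg_unit exprD expr1.
by apply: le_trans (ler_nrmM _ _ _ r0) _; rewrite ler_pM // nrm_ge0.
Qed.

Lemma ler_nrm_mon r N m : 0 <= r -> nrm r N (fmon K m) <= r ^+ mdeg m.
Proof.
move=> r0; apply: le_trans (_ : nrm r (maxn N (mdeg m).+1) (fmon K m) <= _).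
  by rewrite ler_nrm_N ?leq_maxl.
rewrite /nrm (bigID (pred1 m)) /= sum_mons1 ?leq_maxr // eqxx normr1 mul1r.
by rewrite big1 ?addr0 // => p /negbTE h; rewrite h normr0 mul0r.
Qed.

Lemma ler_nrmX r N i : 0 <= r -> nrm r N (fX K i) <= r.
Proof. by move=> /(ler_nrm_mon N (munit i)); rewrite mdeg_unit. Qed.

(** The method of majorants: submultiplicativity bounds the norm of Phi^k by the
    power of s with exponent the degree of k. *)
Lemma ler_nrm_comp r s N a Phi : 0 <= r -> 0 <= s -> (forall i, ord_ge 1 (Phi i)) ->
  (forall i, nrm r N (Phi i) <= s) -> nrm r N (fcomp a Phi) <= nrm s N a.
Proof.
move=> r0 s0 h1 h; apply: (@le_trans _ _
   (\sum_(k <- mons N) `|a k| * nrm r N (powm Phi k))); last first.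
  by apply: ler_sum => k _; rewrite ler_wpM2l // ler_nrm_powm.
under [leRHS]eq_bigr do rewrite mulr_sumr; rewrite exchange_big /=.
rewrite /nrm big_seq [leRHS]big_seq; apply: ler_sum => m; rewrite mem_mons => mN.
rewrite (fcompE h1 _ mN); apply: le_trans (ler_wpM2r _ (ler_norm_sum _ _ _)) _.
  exact: exprn_ge0.
by rewrite mulr_suml; apply: ler_sum => k _; rewrite normrM mulrA.
Qed.

Lemma ler_nrm_comp_shift r s N a Phi : 0 <= r -> 0 <= s -> ord_ge 2 a ->
  (forall i, ord_ge 1 (Phi i)) ->
  (forall i, nrm r N (Phi i) <= s) -> nrm r N.+1 (fcomp a Phi) <= nrm s N.+1 a.
Proof.
case: N => [|N] r0 s0 a2 h1 h.
  rewrite (@nrm_congr _ _ _ 0) ?nrm0 ?nrm_ge0 // subr0.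
  by apply: ord_geW (ord_ge_comp _ a2).
rewrite (@nrm_congr _ _ _ (fcomp a (fun i => ftrunc N.+1 (Phi i)))).
  apply: ler_nrm_comp => // i; first exact: ord_ge_ftrunc.
  by rewrite nrm_trunc.
apply: ord_ge_compB => // i; first exact: ord_ge_ftrunc.
exact: ord_ge_trunc.
Qed.

Lemma ler_nrm_scale n t s N a : 0 <= t -> t <= 1 -> 0 <= s -> ord_ge n a ->
  nrm (t * s) N a <= t ^+ n * nrm s N a.
Proof.
move=> t0 t1 s0 an; rewrite /nrm mulr_sumr; apply: ler_sum => m _.
case: (ltnP (mdeg m) n) => h; first by rewrite an // normr0 !mul0r mulr0.
rewrite exprMn mulrCA ler_wpM2r ?mulr_ge0 ?exprn_ge0 //.
by apply: ler_wiXn2l.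
Qed.

Lemma nrm_mulX r N a i : nrm r N.+1 (a * fX K i) = nrm r N a * r.
Proof.
rewrite /nrm (bigID (fun m : mon3 => 0 < m i)%N) /= [X in _ + X]big1 ?addr0; last first.
  move=> m; rewrite -leqNgt leqn0 => /eqP mi.
  by rewrite fcoef_mulmon0 ?normr0 ?mul0r //; exists i; rewrite ffunE eqxx mi.
rewrite -sum_mons_shift mulr_suml; apply: eq_bigr => m _.
by rewrite fcoef_mulmon mdegD mdeg_unit addn1 exprSr mulrA.
Qed.

(** * Convergent series *)

Definition bounded_at s (M : K) a := forall N, nrm s N a <= M.
Definition fconv a := exists s M, 0 < s /\ bounded_at s M a.

Lemma bounded_at_ge0 s M a : bounded_at s M a -> 0 <= M.
Proof.
by move=> /(_ 0%N); rewrite /nrm big_seq big1 // => m; rewrite mem_mons.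
Qed.

Lemma bounded_at_r r s M a : 0 <= r -> r <= s -> bounded_at s M a -> bounded_at r M a.
Proof. by move=> r0 rs h N; apply: le_trans (h N); exact: ler_nrm_r. Qed.

(** The radius 1 / (1 + sum of the 1 / s_i) is below every s_i; it replaces a
    minimum, since the order of K is partial. *)
Lemma fconv_family (I : finType) (F : I -> fser K) : (forall i, fconv (F i)) ->
  exists s M, 0 < s /\ forall i, bounded_at s M (F i).
Proof.
move=> /choice[s /choice[M h]]; pose T := 1 + \sum_i (s i)^-1.
have si i : 0 < s i by case: (h i).
have T0 : 0 < T by rewrite ltr_pwDl // sumr_ge0 // => i _; rewrite invr_ge0 ltW.
exists T^-1, (\sum_i M i); split; first by rewrite invr_gt0.
have M0 i : 0 <= M i by apply: bounded_at_ge0 (h i).2.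
move=> i N; apply: (@le_trans _ _ (M i)); last first.
  by rewrite (bigD1 i) //= lerDl sumr_ge0.
apply: (bounded_at_r _ _ (h i).2); first by rewrite invr_ge0 ltW.
rewrite -[leRHS]invrK lef_pV2 ?posrE ?invr_gt0 //.
apply: (@le_trans _ _ (\sum_i (s i)^-1)); last by rewrite lerDr.
by rewrite (bigD1 i) //= lerDl sumr_ge0 // => j _; rewrite invr_ge0 ltW.
Qed.

Lemma fconv_pair a b : fconv a -> fconv b ->
  exists s M, [/\ 0 < s, bounded_at s M a & bounded_at s M b].
Proof.
move=> ha hb; have [|s [M [s0 h]]] := @fconv_family bool (fun x => if x then a else b).
  by case.
by exists s, M; split => //; [exact: (h true) | exact: (h false)].
Qed.

Lemma fconvD a b : fconv a -> fconv b -> fconv (a + b).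
Proof.
move=> ha hb; have [s [M [s0 h1 h2]]] := fconv_pair ha hb.
exists s, (M + M); split => // N; apply: le_trans (ler_nrmD _ _ _ (ltW s0)) _.
exact: lerD.
Qed.

Lemma fconvN a : fconv a -> fconv (- a).
Proof. by case=> s [M [s0 h]]; exists s, M; split => // N; rewrite nrmN. Qed.

Lemma fconv0 : fconv 0.
Proof. by exists 1, 0; split => // N; rewrite nrm0. Qed.

Lemma fconv_sum I (r : seq I) (P : pred I) (F : I -> fser K) :
  (forall i, P i -> fconv (F i)) -> fconv (\sum_(i <- r | P i) F i).
Proof. by move=> h; elim/big_ind: _ => //; [exact: fconv0 | exact: fconvD]. Qed.

Lemma fconvM a b : fconv a -> fconv b -> fconv (a * b).
Proof.
move=> ha hb; have [s [M [s0 h1 h2]]] := fconv_pair ha hb.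
exists s, (M * M); split => // N; apply: le_trans (ler_nrmM _ _ _ (ltW s0)) _.
by apply: ler_pM => //; apply: nrm_ge0; exact: ltW.
Qed.

Lemma fconv_mon m : fconv (fmon K m).
Proof. by exists 1, 1; split => // N; have := @ler_nrm_mon 1 N m ler01; rewrite expr1n. Qed.

Lemma fconv_const x : fconv (fconst x).
Proof.
exists 1, `|x|; split => // N; case: N => [|N].
  by rewrite /nrm big_seq big1 // => m; rewrite mem_mons.
rewrite /nrm (bigID (pred1 mzero)) /= sum_mons1 ?mdeg0 // eqxx expr1n !mulr1.
by rewrite big1 ?addr0 // => p /negbTE h; rewrite h mulr0 normr0 mul0r.
Qed.

(** The factor k + 1 <= 2^k produced by the derivative is absorbed by halving the
    radius. *)
Lemma ler_nrm_deriv s N i a : 0 < s -> nrm (s / 2%:R) N (fderiv i a) <= s^-1 * nrm s N.+1 a.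
Proof.
move=> s0; rewrite ler_pdivlMl // /nrm mulr_sumr.
apply: (@le_trans _ _ (\sum_(m <- mons N.+1 | (0 < m i)%N) `|a m| * s ^+ mdeg m)).
  rewrite -sum_mons_shift; apply: ler_sum => m _.
  rewrite fderivE mdegD mdeg_unit addn1 normrM normr_nat exprMn exprVn exprS.
  have -> : s * ((m i).+1%:R * `|a (madd m (munit i))| * (s ^+ mdeg m * (2%:R ^+ mdeg m)^-1)) =
    `|a (madd m (munit i))| * (s * s ^+ mdeg m) * ((m i).+1%:R / 2%:R ^+ mdeg m) by ring.
  rewrite ler_piMr ?mulr_ge0 ?exprn_ge0 ?(ltW s0) //.
  rewrite ler_pdivrMr ?exprn_gt0 ?ltr0n // mul1r -natrX ler_nat.
  by apply: leq_trans (ltn_expl _ _) => //; rewrite ltnS leq_mdeg.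
rewrite big_mkcond; apply: ler_sum => m _; case: ifP => // _.
by rewrite mulr_ge0 ?exprn_ge0 // ltW.
Qed.

Lemma bounded_at_deriv s M i a : 0 < s -> bounded_at s M a ->
  bounded_at (s / 2%:R) (s^-1 * M) (fderiv i a).
Proof.
move=> s0 h N; apply: le_trans (ler_nrm_deriv N i a s0) _.
by rewrite ler_wpM2l // invr_ge0 ltW.
Qed.

Lemma fconv_deriv i a : fconv a -> fconv (fderiv i a).
Proof.
case=> s [M [s0 h]]; exists (s / 2%:R), (s^-1 * M); split.
  by rewrite divr_gt0 ?ltr0n.
exact: bounded_at_deriv.
Qed.

(** As Phi has order at least 1, its norm shrinks at least as fast as the radius,
    and thus falls below a radius s at which a is bounded. *)
Lemma fconv_comp a Phi : fconv a -> (forall i, fconv (Phi i)) ->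
  (forall i, ord_ge 1 (Phi i)) -> fconv (fcomp a Phi).
Proof.
case=> s [M [s0 h]] /fconv_family[r [M' [r0 h']]] h1.
have M'0 : 0 <= M' := bounded_at_ge0 (h' o0).
pose t := (1 + M' / s)^-1.
have T0 : 0 < 1 + M' / s by rewrite ltr_pwDl // divr_ge0 // ltW.
have t0 : 0 < t by rewrite invr_gt0.
exists (t * r), M; split; first exact: mulr_gt0.
have tr0 : 0 <= t * r by rewrite mulr_ge0 ?ltW.
move=> N; apply: le_trans (h N); apply: ler_nrm_comp => //; first exact: ltW.
move=> i; apply: le_trans (@ler_nrm_scale 1 t r N _ _ _ _ _) _ => //; try exact: ltW.
  by rewrite invf_le1 // lerDl divr_ge0 // ltW.
rewrite expr1 ler_pdivrMl // mulrDl mul1r divfK ?gt_eqF //.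
by apply: le_trans (h' i N) _; rewrite lerDr ltW.
Qed.

(** For r with C r <= 1, the bound r in degrees < N implies the bound
    C r^2 <= r in degrees < N + 1. *)
Lemma fconv_of_quadratic_gain y (s0 C : K) : 0 < s0 -> 0 <= C ->
  (forall r N, 0 < r -> r <= s0 -> (forall i, nrm r N (y i) <= r) ->
     forall i, nrm r N.+1 (y i) <= C * r ^+ 2) ->
  forall i, fconv (y i).
Proof.
move=> s0p C0 h; pose r := (s0^-1 + C)^-1.
have T0 : 0 < s0^-1 + C by rewrite ltr_wpDr // invr_gt0.
have r0 : 0 < r by rewrite invr_gt0.
have rs : r <= s0 by rewrite -[leRHS]invrK lef_pV2 ?posrE ?invr_gt0 // lerDl.
have Cr : C * r <= 1 by rewrite ler_pdivrMr // mul1r lerDr invr_ge0 ltW.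
have B N i : nrm r N (y i) <= r.
  elim: N i => [|N IH] i.
    by rewrite /nrm big_seq big1 ?ltW // => m; rewrite mem_mons.
  apply: le_trans (h _ _ r0 rs IH i) _.
  by rewrite expr2 mulrA ler_piMl // ltW.
by move=> i; exists r, r; split.
Qed.

Lemma near_id_bound r N y : 0 < r -> (forall i, nrm r N (y i) <= r) ->
  forall i, nrm r N (near_id y i) <= 2%:R * r.
Proof.
move=> r0 h i; apply: le_trans (ler_nrmD _ _ _ (ltW r0)) _.
by rewrite mulrDl mul1r; apply: lerD => //; apply: ler_nrmX; exact: ltW.
Qed.

(** The map id + y has size at most 2r; as a has order at least 2, its norm at
    radius 2r is at most (2r/s)^2 times its norm at radius s. *)
Lemma order2_comp_bound r N s M a y : 0 < s -> bounded_at s M a -> ord_ge 2 a ->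
  (forall i, ord_ge 2 (y i)) -> 0 < r -> r <= s / 2%:R ->
  (forall i, nrm r N (y i) <= r) ->
  nrm r N.+1 (fcomp a (near_id y)) <= (2%:R / s) ^+ 2 * M * r ^+ 2.
Proof.
move=> s0 aM a2 y2 r0 rs yr.
have s2 : 2%:R * r <= s by rewrite mulrC -ler_pdivlMr ?ltr0n.
have r20 : 0 <= 2%:R * r by rewrite mulr_ge0 ?ler0n // ltW.
apply: le_trans (@ler_nrm_comp_shift r (2%:R * r) N a _ (ltW r0) r20 a2 (near_id1 y2) _) _.
  exact: near_id_bound.
have -> : 2%:R * r = (2%:R * r / s) * s by rewrite divfK ?gt_eqF.
apply: le_trans (@ler_nrm_scale 2 _ _ _ _ _ _ (ltW s0) a2) _.
- by rewrite divr_ge0 // ltW.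
- by rewrite ler_pdivrMr // mul1r.
have -> : (2%:R / s) ^+ 2 * M * r ^+ 2 = (2%:R * r / s) ^+ 2 * M by rewrite !exprMn; ring.
by rewrite ler_wpM2l // exprn_ge0 // divr_ge0 // ltW.
Qed.

Lemma fconv_inverse phi psi : (forall i, ord_ge 2 (phi i)) -> (forall i, ord_ge 2 (psi i)) ->
  (forall i, psi i = - fcomp (phi i) (near_id psi)) ->
  (forall i, fconv (phi i)) -> forall i, fconv (psi i).
Proof.
move=> p2 s2 e /fconv_family[s [M [s0 h]]].
have M0 := bounded_at_ge0 (h o0).
apply: (@fconv_of_quadratic_gain _ (s / 2%:R) ((2%:R / s) ^+ 2 * M)).
- by rewrite divr_gt0 ?ltr0n.
- by rewrite mulr_ge0 ?exprn_ge0 // divr_ge0 ?ler0n // ltW.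
move=> r N r0 rs hr i; rewrite e nrmN; exact: order2_comp_bound.
Qed.

(** Dividing by x_i turns the bound O(r^2) on g x_i into a bound O(r) on g; its
    product with phi_i, of norm at most r, is O(r^2) again. *)
Lemma fconv_linearization phi g (h : 'I_3 -> fser K) (C : K) :
  (forall i, ord_ge 2 (phi i)) -> ord_ge 1 g ->
  (forall i, ord_ge 2 (h i)) -> (forall i, fconv (h i)) -> 0 <= C ->
  (forall i m, `|(g * fX K i) m| <= C * `|fcomp (h i) (near_id phi) m| /\
     `|phi i m| <= C * (`|fcomp (h i) (near_id phi) m| + `|(g * phi i) m|)) ->
  forall i, fconv (phi i).
Proof.
move=> p2 g1 h2 /fconv_family[s [M [s0 hM]]] C0 est.
have M0 := bounded_at_ge0 (hM o0).
pose B := (2%:R / s) ^+ 2 * M.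
have B0 : 0 <= B by rewrite mulr_ge0 ?exprn_ge0 // divr_ge0 ?ler0n // ltW.
apply: (@fconv_of_quadratic_gain _ (s / 2%:R) (C * (B + C * B))).
- by rewrite divr_gt0 ?ltr0n.
- by rewrite mulr_ge0 // addr_ge0 // mulr_ge0.
move=> r N r0 rs hr i; have r0' := ltW r0.
have H j : nrm r N.+1 (fcomp (h j) (near_id phi)) <= B * r ^+ 2.
  exact: order2_comp_bound.
have gr : nrm r N g <= C * B * r.
  rewrite -(ler_pM2r r0) -(nrm_mulX r N g o0).
  have -> : C * B * r * r = C * (B * r ^+ 2) by ring.
  apply: le_trans (_ : C * nrm r N.+1 (fcomp (h o0) (near_id phi)) <= _); last first.
    by rewrite ler_wpM2l.
  rewrite -[leRHS]addr0 -[X in _ + X](mulr0 C) -(nrm0 r N.+1) -mulrDr.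
  apply: ler_nrm_comb => // m; rewrite fcoef0 normr0 addr0.
  exact: (est o0 m).1.
apply: le_trans (ler_nrm_comb N.+1 r0' (fun m => (est i m).2)) _.
rewrite -mulrA ler_wpM2l // mulrDl; apply: lerD => //.
apply: le_trans (ler_nrmM_shift _ r0' g1 (ord_geW _ (p2 i))) _ => //.
rewrite expr2 mulrA; apply: ler_pM => //; exact: nrm_ge0.
Qed.

End Norm.

(** * Evaluation of convergent series *)

Local Open Scope classical_set_scope.
Local Open Scope ring_scope.

(** All series below are compared with a geometric series of ratio 1/2, so that
    this form of completeness is sufficient. *)
Definition geom_complete (K : numFieldType) : Prop :=
  (forall e : K, 0 < e -> exists n : nat, 2%:R ^- n < e) /\
  (forall (u : nat -> K) (M : K), (forall n, `|u n.+1 - u n| <= M * 2%:R ^- n) ->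
     exists l : K, u @ \oo --> l).

Section Analysis.
Variable K : numFieldType.
Hypothesis Kc : geom_complete K.
Implicit Types (a b c : fser K) (r s t M e : K) (x y v : 'rV[K]_3).
Implicit Types m p q : mon3.

Lemma half_small M e : 0 <= M -> 0 < e -> \forall n \near \oo, M * 2%:R ^- n < e.
Proof.
move=> M0 e0; have e0' : 0 < e / (M + 1) by rewrite divr_gt0 // ltr_wpDl.
have [N hN] := Kc.1 _ e0'; apply: filterS (nbhs_infty_ge N) => n /= hn.
apply: (@le_lt_trans _ _ ((M + 1) * 2%:R ^- n)).
  by rewrite ler_wpM2r ?lerDl // invr_ge0 exprn_ge0.
rewrite -ltr_pdivlMl ?ltr_wpDl // mulrC; apply: le_lt_trans hN.
by rewrite lef_pV2 ?posrE ?exprn_gt0 // ler_weXn2l // ler1n.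
Qed.

Lemma cvg_half_close (u w : nat -> K) M (l : K) :
  (forall n, `|u n - w n| <= M * 2%:R ^- n) -> w @ \oo --> l -> u @ \oo --> l.
Proof.
move=> h wl; have M0 : 0 <= M.
  by have := le_trans (normr_ge0 _) (h 0%N); rewrite expr0 invr1 mulr1.
apply/cvgrPdist_lt => e e0; have e2 : 0 < e / 2%:R by rewrite divr_gt0.
move/cvgrPdist_lt/(_ _ e2): wl; apply: filterS2 (half_small M0 e2) => n h1 h2.
rewrite (_ : l - u n = (l - w n) - (u n - w n)); last by ring.
rewrite (splitr e); apply: le_lt_trans (ler_normB _ _) _; apply: ltrD => //.
exact: le_lt_trans (h n) h1.
Qed.

Lemma cvg_norm_le (u : nat -> K) M (l : K) :
  u @ \oo --> l -> (forall n, `|u n| <= M) -> `|l| <= M.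
Proof.
move=> ul h; apply/ler_addgt0Pr => e e0; move/cvgrPdist_lt/(_ _ e0): ul => ul.
have [n hn] : exists n, `|l - u n| < e by have [n] := filter_ex ul; exists n.
rewrite -[l](subrK (u n)) addrC; apply: le_trans (ler_normD _ _) _.
by apply: lerD => //; exact: ltW.
Qed.

Definition monx x m : K := \prod_(i < 3) x 0 i ^+ m i.
Definition in_polydisc x r := forall i, `|x 0 i| <= r.
Definition psum a x N : K := \sum_(m <- mons N) a m * monx x m.

Lemma monxD x p q : monx x (madd p q) = monx x p * monx x q.
Proof. by rewrite /monx -big_split; apply: eq_bigr => i _; rewrite ffunE exprD. Qed.

Lemma monx_unit x i : monx x (munit i) = x 0 i.
Proof.
rewrite /monx (bigD1 i) //= ffunE eqxx expr1 big1 ?mulr1 // => j /negbTE h.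
by rewrite ffunE h.
Qed.

Lemma monx0 x : monx x mzero = 1.
Proof. by rewrite /monx big1 // => i _; rewrite ffunE. Qed.

Lemma ler_monx x r m : in_polydisc x r -> `|monx x m| <= r ^+ mdeg m.
Proof.
move=> h; elim/mon_ind: m => [|m i IH]; first by rewrite monx0 normr1 mdeg0.
by rewrite monxD monx_unit mdegD mdeg_unit addn1 exprSr normrM ler_pM.
Qed.

(** In the polydisc of half the radius, terms of degree n gain a factor 2^-n. *)
Lemma tail_bound s M a x N N' (P : pred mon3) : 0 < s -> bounded_at s M a ->
  in_polydisc x (s / 2%:R) ->
  \sum_(m <- mons N' | P m && (N <= mdeg m)%N) `|a m * monx x m| <= M * 2%:R ^- N.
Proof.
move=> s0 aM hx; apply: le_trans (_ : nrm s N' a * 2%:R ^- N <= _); last first.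
  by rewrite ler_wpM2r // invr_ge0 exprn_ge0.
rewrite /nrm mulr_suml [leLHS]big_mkcond; apply: ler_sum => m _.
case: ifP => [/andP[_ hN]|_]; last by rewrite !mulr_ge0 ?exprn_ge0 ?invr_ge0 ?exprn_ge0 // ltW.
rewrite normrM -mulrA ler_wpM2l //; apply: le_trans (ler_monx m hx) _.
rewrite exprMn exprVn ler_wpM2l ?exprn_ge0 ?(ltW s0) //.
by rewrite lef_pV2 ?posrE ?exprn_gt0 // ler_weXn2l // ler1n.
Qed.

Lemma psum_widen a x N N' : (N <= N')%N ->
  psum a x N = \sum_(m <- mons N' | (mdeg m < N)%N) a m * monx x m.
Proof.
move=> h; rewrite (@sum_mons_widen _ N N') //; last by move=> p; rewrite ltnNge => /negbTE ->.
rewrite /psum big_seq [RHS]big_seq_cond; apply: eq_bigl => m.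
by rewrite mem_mons andbb.
Qed.

Lemma psum_dist s M a x N N' : 0 < s -> bounded_at s M a -> in_polydisc x (s / 2%:R) ->
  (N <= N')%N -> `|psum a x N' - psum a x N| <= M * 2%:R ^- N.
Proof.
move=> s0 aM hx h; rewrite (psum_widen _ _ h) /psum (bigID (fun m => mdeg m < N)%N) /=.
rewrite addrAC subrr add0r; apply: le_trans (ler_norm_sum _ _ _) _.
under eq_bigl do rewrite -leqNgt.
exact: (tail_bound N N' predT s0 aM hx).
Qed.

Definition feval a x : K := lim (psum a x @ \oo).

Lemma feval_unique a x (l : K) : psum a x @ \oo --> l -> feval a x = l.
Proof. by move=> h; apply: cvg_lim => //; exact: norm_hausdorff. Qed.

Lemma psum_cvg s M a x : 0 < s -> bounded_at s M a -> in_polydisc x (s / 2%:R) ->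
  psum a x @ \oo --> feval a x.
Proof.
move=> s0 aM hx; have [|l hl] := Kc.2 (psum a x) M.
  by move=> n; exact: (psum_dist s0 aM hx).
by rewrite (feval_unique hl).
Qed.

(** The sums over boxes are compared with the sums over simplices {deg m < N},
    whose index shift under differentiation is exact. *)
Lemma box_sumE (w : K -> K) a x N : box_sum w a x N =
  \sum_(m <- mons (3 * N).+1 | [forall i, m i < N]%N) w (a m * monx x m).
Proof.
transitivity (\sum_(m <- [seq [ffun i => k i : nat] | k : {ffun 'I_3 -> 'I_N}])
   w (a m * monx x m)).
  rewrite big_map big_enum /=; apply: eq_bigr => k _; congr (w (_ * _)).
  by apply: eq_bigr => i _; rewrite ffunE.
rewrite -[RHS]big_filter; apply: perm_big; apply: uniq_perm.
- rewrite map_inj_uniq ?enum_uniq // => k k' /ffunP h.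
  by apply/ffunP => i; apply: val_inj; move: (h i); rewrite !ffunE.
- exact/filter_uniq/mons_uniq.
move=> m; rewrite mem_filter mem_mons; apply/mapP/andP => [[k _ ->]|[/forallP h _]].
  split; first by apply/forallP => i; rewrite ffunE.
  rewrite ltnS /mdeg; apply: leq_trans (_ : \sum_(i < 3) N <= _)%N.
    by apply: leq_sum => i _; rewrite ffunE; exact: ltnW.
  by rewrite sum_nat_const card_ord.
exists [ffun i => Ordinal (h i)]; first by rewrite mem_enum.
by apply/ffunP => i; rewrite !ffunE.
Qed.

Lemma box_sum_norm_le s M a x N : 0 < s -> bounded_at s M a -> in_polydisc x s ->
  box_sum Num.norm a x N <= M.
Proof.
move=> s0 aM hx; rewrite box_sumE; apply: le_trans (aM (3 * N).+1).
rewrite big_mkcond; apply: ler_sum => m _; case: ifP => _; last first.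
  by rewrite mulr_ge0 // exprn_ge0 // ltW.
by rewrite normrM ler_wpM2l // ler_monx.
Qed.

Lemma box_sum_dist s M a x N : 0 < s -> bounded_at s M a -> in_polydisc x (s / 2%:R) ->
  `|box_sum id a x N - psum a x N| <= M * 2%:R ^- N.
Proof.
move=> s0 aM hx; have hN : (N <= (3 * N).+1)%N by lia.
rewrite (psum_widen _ _ hN) box_sumE (bigID (fun m => mdeg m < N)%N) /=.
rewrite (eq_bigl (fun m => (mdeg m < N)%N)); last first.
  move=> m; case: ltnP => h; last by rewrite andbF.
  by rewrite andbT; apply/forallP => i; exact: leq_ltn_trans (leq_mdeg m i) h.
rewrite addrAC subrr add0r; apply: le_trans (ler_norm_sum _ _ _) _.
under eq_bigl do rewrite -leqNgt.
exact: (tail_bound N _ [pred m : mon3 | [forall i, m i < N]%N] s0 aM hx).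
Qed.

Lemma sums_to_feval s M a x : 0 < s -> bounded_at s M a -> in_polydisc x (s / 2%:R) ->
  fps3_sums_to a x (feval a x).
Proof.
move=> s0 aM hx; split.
  exists M => N; apply: (box_sum_norm_le N s0 aM) => i; apply: le_trans (hx i) _.
  by rewrite ler_pdivrMr // ler_peMr ?ltW // ltr1n.
apply: (@cvg_half_close _ (psum a x) M); last exact: (psum_cvg s0 aM).
by move=> n; exact: (box_sum_dist _ s0 aM).
Qed.

Lemma sums_to_unique s M a x (l : K) : 0 < s -> bounded_at s M a -> in_polydisc x (s / 2%:R) ->
  fps3_sums_to a x l -> l = feval a x.
Proof.
move=> s0 aM hx [_ hl]; have [_ hl'] := sums_to_feval s0 aM hx.
by apply: (cvg_unique (@norm_hausdorff _ K) hl hl').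
Qed.

Lemma coord_le_norm n (x : 'rV[K]_n) i : `|x 0 i| <= `|x|.
Proof.
rewrite [leRHS]mx_normE -[leLHS]nngE num_le.
exact: (le_bigmax _ (fun ij : 'I_1 * 'I_n => `|x ij.1 ij.2|%:nng) (0, i)).
Qed.

Lemma norm_le_coord n (x : 'rV[K]_n) r : 0 <= r -> (forall i, `|x 0 i| <= r) -> `|x| <= r.
Proof.
move=> r0 h; have [e|] := eqVneq (mx_norm x) 0.
  by rewrite -[`|x|]/(mx_norm x) e.
by case/mx_norm_neq0 => -[i j] e; rewrite -[`|x|]/(mx_norm x) e /= ord1.
Qed.

(** Absolute convergence at a single point with equal positive coordinates is a
    bound for the norms at that radius. *)
Lemma taylor_fconv (f : 'rV[K]_3 -> K) a : taylor_at0 f (fcoef a) -> fconv a.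
Proof.
move=> /nbhs_norm0P[e /= e0 h]; have e2 : 0 < e / 2%:R by rewrite divr_gt0.
pose x : 'rV[K]_3 := const_mx (e / 2%:R).
have [|[M hM] _] := h x.
  apply: le_lt_trans (norm_le_coord (ltW e2) _) _ => [i|].
    by rewrite mxE ger0_norm // ltW.
  by rewrite ltr_pdivrMr // ltr_pMr // ltr1n.
exists (e / 2%:R), M; split => // N; apply: le_trans (hM N).
rewrite box_sumE (nrm_widen _ _ (_ : (N <= (3 * N).+1)%N)); last by lia.
rewrite big_mkcond [leRHS]big_mkcond; apply: ler_sum => m _.
have -> : `|a m * monx x m| = `|a m| * (e / 2%:R) ^+ mdeg m.
  rewrite normrM; congr (_ * _); elim/mon_ind: m => [|m i IH].
    by rewrite monx0 mdeg0 normr1.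
  rewrite monxD monx_unit normrM IH mdegD mdeg_unit addn1 exprSr mxE.
  by rewrite ger0_norm // ltW.
case: ltnP => h1; last by case: ifP => // _; rewrite mulr_ge0 // exprn_ge0 // ltW.
rewrite (_ : [forall i, _] = true) //; apply/forallP => i.
exact: leq_ltn_trans (leq_mdeg m i) h1.
Qed.

Lemma fconv_taylor a : fconv a -> taylor_at0 (feval a) (fcoef a).
Proof.
case=> s [M [s0 aM]]; apply/nbhs_norm0P; exists (s / 2%:R); first by rewrite /= divr_gt0.
move=> x /= hx; apply: (sums_to_feval s0 aM) => i.
by apply: le_trans (coord_le_norm x i) (ltW hx).
Qed.

Lemma taylor_eq_feval f a : taylor_at0 f (fcoef a) ->
  \forall x \near (0 : 'rV[K]_3), f x = feval a x.
Proof.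
move=> ta; have [s [M [s0 aM]]] := taylor_fconv ta.
have h : \forall x \near (0 : 'rV[K]_3), `|x| < s / 2%:R.
  by apply/nbhs_norm0P; exists (s / 2%:R) => //; rewrite /= divr_gt0.
apply: filterS2 ta h => x h1 h2; apply: (sums_to_unique s0 aM) => // i.
by apply: le_trans (coord_le_norm x i) (ltW h2).
Qed.

Lemma feval_near a : fconv a -> \forall x \near (0 : 'rV[K]_3), psum a x @ \oo --> feval a x.
Proof.
case=> s [M [s0 aM]]; apply/nbhs_norm0P; exists (s / 2%:R); first by rewrite /= divr_gt0.
move=> x /= hx; apply: (psum_cvg s0 aM) => i.
by apply: le_trans (coord_le_norm x i) (ltW hx).
Qed.

Lemma feval0 x : feval 0 x = 0.
Proof.
apply: feval_unique; rewrite (_ : psum 0 x = fun=> 0); first exact: cvg_cst.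
by apply: funext => n; rewrite /psum big1 // => m _; rewrite fcoef0 mul0r.
Qed.

Lemma fevalD a b : fconv a -> fconv b ->
  \forall x \near (0 : 'rV[K]_3), feval (a + b) x = feval a x + feval b x.
Proof.
move=> ha hb; apply: filterS2 (feval_near ha) (feval_near hb) => x h1 h2.
apply: feval_unique; rewrite (_ : psum (a + b) x = psum a x \+ psum b x); last first.
  apply: funext => n; rewrite /psum /= -big_split; apply: eq_bigr => m _.
  by rewrite mulrDl.
exact: (@cvgD _ K^o).
Qed.

Lemma fevalN a : fconv a ->
  \forall x \near (0 : 'rV[K]_3), feval (- a) x = - feval a x.
Proof.
move=> ha; apply: filterS (feval_near ha) => x h1.
apply: feval_unique; rewrite (_ : psum (- a) x = \- psum a x); last first.
  apply: funext => n; rewrite /psum /= -sumrN; apply: eq_bigr => m _.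
  by rewrite mulNr.
exact: (@cvgN _ K^o).
Qed.

(** The product of the partial sums differs from the partial sum of the product
    by terms of total degree at least N. *)
Lemma psumM_dist s M M' a b x N : 0 < s -> bounded_at s M a -> bounded_at s M' b ->
  in_polydisc x (s / 2%:R) ->
  `|psum (a * b) x N - psum a x N * psum b x N| <= M * M' * 2%:R ^- N.
Proof.
move=> s0 aM bM hx; pose F p q := (a p * monx x p) * (b q * monx x q).
have -> : psum (a * b) x N =
    \sum_(p <- mons N) \sum_(q <- mons N | (mdeg (madd p q) < N)%N) F p q.
  transitivity (\sum_(m <- mons N) \sum_(p <- mons N)
      \sum_(q <- mons N | madd p q == m) F p q).
    rewrite /psum big_seq [RHS]big_seq; apply: eq_bigr => m; rewrite mem_mons => mN.
    rewrite (fcoefM _ _ mN) mulr_suml; apply: eq_bigr => p _.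
    rewrite mulr_suml; apply: eq_bigr => q /eqP <-; rewrite /F monxD; ring.
  rewrite exchange_big; apply: eq_bigr => p _ /=.
  rewrite (exchange_big_dep predT) //= [RHS]big_mkcond; apply: eq_bigr => q _.
  under eq_bigl do rewrite eq_sym.
  case: ltnP => h; first by rewrite sum_mons1.
  rewrite big_seq_cond big1 // => m /andP[]; rewrite mem_mons => hm /eqP e.
  by move: h; rewrite -e leqNgt hm.
rewrite /psum mulr_suml -sumrB.
apply: (@le_trans _ _ (\sum_(p <- mons N) \sum_(q <- mons N)
   (`|a p| * s ^+ mdeg p) * (`|b q| * s ^+ mdeg q) * 2%:R ^- N)).
  apply: le_trans (ler_norm_sum _ _ _) _; apply: ler_sum => p _.
  rewrite mulr_sumr (bigID (fun q => mdeg (madd p q) < N)%N predT) /=.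
  rewrite opprD addrA subrr sub0r normrN; apply: le_trans (ler_norm_sum _ _ _) _.
  rewrite big_mkcond; apply: ler_sum => q _; case: ifP => [|_]; last first.
    by rewrite !mulr_ge0 ?exprn_ge0 ?invr_ge0 ?exprn_ge0 // ltW.
  rewrite -leqNgt mdegD => hN; rewrite !normrM.
  have -> : `|a p| * s ^+ mdeg p * (`|b q| * s ^+ mdeg q) * 2%:R ^- N =
     (`|a p| * `|b q|) * ((s ^+ mdeg p * s ^+ mdeg q) * 2%:R ^- N) by ring.
  rewrite mulrACA ler_wpM2l ?mulr_ge0 //.
  apply: le_trans (ler_pM _ _ (ler_monx p hx) (ler_monx q hx)) _ => //.
  rewrite -!exprD exprMn exprVn ler_wpM2l ?exprn_ge0 ?(ltW s0) //.
  by rewrite lef_pV2 ?posrE ?exprn_gt0 // ler_weXn2l // ler1n.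
under eq_bigr do rewrite -mulr_suml -mulr_sumr.
rewrite -mulr_suml -mulr_suml; apply: ler_wpM2r; first by rewrite invr_ge0 exprn_ge0.
by apply: ler_pM => //; [exact: nrm_ge0 (ltW s0)|exact: nrm_ge0 (ltW s0)|exact: aM|exact: bM].
Qed.

Lemma fevalM a b : fconv a -> fconv b ->
  \forall x \near (0 : 'rV[K]_3), feval (a * b) x = feval a x * feval b x.
Proof.
move=> ha hb; have [s [M [s0 aM bM]]] := fconv_pair ha hb.
apply/nbhs_norm0P; exists (s / 2%:R); first by rewrite /= divr_gt0.
move=> x /= hx; have hx' : in_polydisc x (s / 2%:R).
  by move=> i; apply: le_trans (coord_le_norm x i) (ltW hx).
apply: feval_unique; apply: (@cvg_half_close _ (psum a x \* psum b x) (M * M)).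
  by move=> n; exact: (psumM_dist n s0 aM bM hx').
apply: cvgM; [exact: (psum_cvg s0 aM)|exact: (psum_cvg s0 bM)].
Qed.

Lemma feval_sum (I : finType) (F : I -> fser K) : (forall i, fconv (F i)) ->
  \forall x \near (0 : 'rV[K]_3), feval (\sum_i F i) x = \sum_i feval (F i) x.
Proof.
move=> hF; suff h : forall r : seq I, \forall x \near (0 : 'rV[K]_3),
    feval (\sum_(i <- r) F i) x = \sum_(i <- r) feval (F i) x by exact: h.
elim=> [|i r IH].
  by apply/nbhs_norm0P; exists 1 => /= [|x _]; rewrite ?ltr01 ?big_nil ?feval0.
have h2 : fconv (\sum_(j <- r) F j) by apply: fconv_sum => j _; exact: hF.
apply: filterS2 (fevalD (hF i) h2) IH => x e1 e2.
by rewrite !big_cons e1 e2.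
Qed.

(** * Differentiation of convergent series *)

(** The differential of x^m at x, applied to v.  The truncated exponent m - e_i
    is not the true one only when m_i = 0, where the factor m_i vanishes. *)
Definition lin_mon x v m : K :=
  \sum_(i < 3) v 0 i * ((m i)%:R * monx x (msub m (munit i))).

Lemma lin_monD x v m j :
  lin_mon x v (madd m (munit j)) = x 0 j * lin_mon x v m + v 0 j * monx x m.
Proof.
have E i : (madd m (munit j) i)%:R * monx x (msub (madd m (munit j)) (munit i)) =
   x 0 j * ((m i)%:R * monx x (msub m (munit i))) + (j == i)%:R * monx x m.
  rewrite ffunE natrD mulrDl ffunE [i == j]eq_sym; congr (_ + _).
    case: (posnP (m i)) => [->|mi]; first by rewrite !mul0r mulr0.
    rewrite [RHS]mulrCA; congr (_ * _); rewrite -monx_unit -monxD; congr monx.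
    apply/ffunP => k; rewrite !ffunE; case: (eqVneq k i) => [->|_] /=.
      by rewrite addnC addnBA.
    by rewrite !subn0 addnC.
  by case: eqVneq => [->|_]; rewrite ?mul0r // maddK.
rewrite /lin_mon; under eq_bigr do rewrite E mulrDr.
rewrite big_split /= mulr_sumr; congr (_ + _).
  by apply: eq_bigr => i _; rewrite mulrCA.
rewrite (bigD1 j) //= eqxx mul1r big1 ?addr0 // => i /negbTE ij.
by rewrite eq_sym ij mul0r mulr0.
Qed.

Lemma ler_lin_mon x v r t m : in_polydisc x r -> in_polydisc v t ->
  `|lin_mon x v m| <= (mdeg m)%:R * r ^+ (mdeg m).-1 * t.
Proof.
move=> hx hv; have r0 : 0 <= r := le_trans (normr_ge0 _) (hx 0).
have t0 : 0 <= t := le_trans (normr_ge0 _) (hv 0).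
elim/mon_ind: m => [|m j IH].
  by rewrite /lin_mon big1 ?normr0 ?mdeg0 ?mul0r // => i _; rewrite ffunE mul0r mulr0.
rewrite lin_monD mdegD mdeg_unit addn1 /=.
apply: le_trans (ler_normD _ _) _; rewrite !normrM.
apply: (@le_trans _ _ (r * ((mdeg m)%:R * r ^+ (mdeg m).-1 * t) + t * r ^+ mdeg m)).
  apply: lerD; first by apply: ler_pM => //; exact: hx.
  by apply: ler_pM => //; exact: (ler_monx m hx).
rewrite le_eqVlt; apply/orP; left; apply/eqP.
by case: (mdeg m) => [|n] /=; rewrite ?exprS ?expr0 !mulrS; ring.
Qed.

(** If x and v have size at most r and t <= r, the second-order remainder of x^m
    is at most (t/r)^2 times its value in one variable for x = v = r, which is
    (2^n - 1 - n) r^n with n the degree of m. *)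
Lemma mon_remainder x v r t m : 0 < r -> in_polydisc x r -> in_polydisc v t -> t <= r ->
  `|monx (x + v) m - monx x m - lin_mon x v m| * r ^+ 2 <=
    t ^+ 2 * (2%:R ^+ mdeg m - (mdeg m)%:R - 1) * r ^+ mdeg m.
Proof.
move=> r0 hx hv tr; have t0 : 0 <= t := le_trans (normr_ge0 _) (hv 0).
have r0' := ltW r0.
elim/mon_ind: m => [|m j IH].
  rewrite !monx0 mdeg0 expr0 /lin_mon big1 => [|i _]; last by rewrite ffunE mul0r mulr0.
  by rewrite !subr0 !subrr normr0 mulr0 !mul0r.
rewrite lin_monD !monxD !monx_unit mdegD mdeg_unit addn1 mxE.
set A := monx (x + v) m in IH *; set B := monx x m in IH *; set L := lin_mon x v m in IH *.
have -> : A * (x 0 j + v 0 j) - B * x 0 j - (x 0 j * L + v 0 j * B) =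
  (x 0 j + v 0 j) * (A - B - L) + v 0 j * L by ring.
apply: (@le_trans _ _ ((2%:R * r) * (`|A - B - L| * r ^+ 2) +
    t * ((mdeg m)%:R * r ^+ (mdeg m).-1 * t) * r ^+ 2)).
  apply: le_trans (ler_wpM2r _ (ler_normD _ _)) _; first by rewrite exprn_ge0.
  rewrite mulrDl !normrM; apply: lerD.
    rewrite -mulrA ler_wpM2r ?mulr_ge0 ?exprn_ge0 //.
    apply: le_trans (ler_normD _ _) _; rewrite mulrDl mul1r.
    by apply: lerD; [exact: hx | exact: le_trans (hv j) tr].
  rewrite ler_wpM2r ?exprn_ge0 //; apply: ler_pM => //; exact: (ler_lin_mon m hx hv).
apply: (@le_trans _ _ ((2%:R * r) * (t ^+ 2 * (2%:R ^+ mdeg m - (mdeg m)%:R - 1) * r ^+ mdeg m) +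
    t * ((mdeg m)%:R * r ^+ (mdeg m).-1 * t) * r ^+ 2)).
  by rewrite lerD2r ler_wpM2l // mulr_ge0.
rewrite le_eqVlt; apply/orP; left; apply/eqP.
by case: (mdeg m) => [|n] /=; rewrite ?exprS ?expr0 !mulrS; ring.
Qed.

Lemma cvg_seqB (u w : nat -> K) (l l' : K) : u @ \oo --> l -> w @ \oo --> l' ->
  (fun n => u n - w n) @ \oo --> l - l'.
Proof. exact: (@cvgB _ K^o). Qed.

Lemma cvg_sum_seq (I : finType) (u : I -> nat -> K) (l : I -> K) :
  (forall i, u i @ \oo --> l i) -> (fun n => \sum_i u i n) @ \oo --> \sum_i l i.
Proof.
move=> h; suff H : forall r : seq I,
    (fun n => \sum_(i <- r) u i n) @ \oo --> \sum_(i <- r) l i by exact: H.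
elim=> [|i r IH].
  rewrite big_nil (_ : (fun=> _) = fun=> 0); first exact: cvg_cst.
  by apply: funext => n; rewrite big_nil.
rewrite big_cons (_ : (fun=> _) = (u i \+ fun n => \sum_(i <- r) u i n)).
  exact: (@cvgD _ K^o).
by apply: funext => n; rewrite big_cons.
Qed.

(** The remainders of the monomials are summed; the radius s/4 makes x + v stay
    in the polydisc of radius s/2. *)
Lemma taylor_remainder s M a x v t : 0 < s -> bounded_at s M a ->
  in_polydisc x (s / 4%:R) -> in_polydisc v t -> t <= s / 4%:R ->
  `|feval a (x + v) - feval a x - \sum_i v 0 i * feval (fderiv i a) x| <=
    (M / (s / 4%:R) ^+ 2) * t ^+ 2.
Proof.
move=> s0 aM hx hv ts; set r := s / 4%:R in hx ts *.
have r0 : 0 < r by rewrite divr_gt0.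
have rs : r + r = s / 2%:R by rewrite /r; field.
have t0 : 0 <= t := le_trans (normr_ge0 _) (hv 0).
have rs' : r <= s / 2%:R by rewrite -rs lerDl ltW.
have hx2 : in_polydisc x (s / 2%:R) by move=> i; exact: le_trans (hx i) rs'.
have hxv : in_polydisc (x + v) (s / 2%:R).
  move=> i; rewrite mxE -rs; apply: le_trans (ler_normD _ _) _.
  by apply: lerD; [exact: hx | exact: le_trans (hv i) ts].
have hx4 : in_polydisc x (s / 2%:R / 2%:R).
  by move=> i; apply: le_trans (hx i) _; rewrite le_eqVlt; apply/orP; left;
    apply/eqP; rewrite /r; field.
have s20 : 0 < s / 2%:R by rewrite divr_gt0.
have c1 := psum_cvg s0 aM hxv; have c2 := psum_cvg s0 aM hx2.
have c3 i := psum_cvg s20 (bounded_at_deriv i s0 aM) hx4.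
pose u N := psum a (x + v) N.+1 - psum a x N.+1 -
   \sum_i v 0 i * psum (fderiv i a) x N.
have cu : u @ \oo --> feval a (x + v) - feval a x - \sum_i v 0 i * feval (fderiv i a) x.
  have sh (w : nat -> K) (l : K) : w @ \oo --> l -> (fun N => w N.+1) @ \oo --> l.
    by rewrite cvg_shiftS.
  apply: cvg_seqB; first by apply: cvg_seqB; exact: sh.
  by apply: cvg_sum_seq => i; apply: cvgM => //; exact: cvg_cst.
apply: (cvg_norm_le cu) => N {cu c1 c2 c3}.
have E : u N = \sum_(m <- mons N.+1) a m * (monx (x + v) m - monx x m - lin_mon x v m).
  rewrite /u; have -> : \sum_i v 0 i * psum (fderiv i a) x N =
      \sum_(m <- mons N.+1) a m * lin_mon x v m.
    under [RHS]eq_bigr do rewrite /lin_mon mulr_sumr.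
    rewrite exchange_big; apply: eq_bigr => i _ /=.
    rewrite [RHS](bigID (fun m : mon3 => 0 < m i)%N) /= [X in _ + X]big1 ?addr0; last first.
      by move=> m; rewrite -leqNgt leqn0 => /eqP ->; rewrite mul0r !mulr0.
    rewrite -sum_mons_shift /psum mulr_sumr; apply: eq_bigr => m _.
    by rewrite fderivE maddK !ffunE eqxx addn1; ring.
  rewrite /psum -!sumrB; apply: eq_bigr => m _; ring.
rewrite {}E; apply: le_trans (ler_norm_sum _ _ _) _.
apply: (@le_trans _ _ (\sum_(m <- mons N.+1) (`|a m| * s ^+ mdeg m) * (t ^+ 2 / r ^+ 2))).
  apply: ler_sum => m _; rewrite normrM -mulrA ler_wpM2l //.
  rewrite mulrA ler_pdivlMr ?exprn_gt0 //.
  apply: le_trans (mon_remainder m r0 hx hv ts) _.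
  rewrite [leRHS]mulrC -mulrA ler_wpM2l ?exprn_ge0 //.
  have -> : s ^+ mdeg m = (2%:R ^+ mdeg m * 2%:R ^+ mdeg m) * r ^+ mdeg m.
    by rewrite -!exprMn /r; congr (_ ^+ _); field.
  rewrite ler_wpM2r ?exprn_ge0 ?(ltW r0) //.
  apply: (@le_trans _ _ (2%:R ^+ mdeg m)); first by rewrite -addrA gerDl -opprD oppr_le0 addr_ge0.
  by rewrite ler_peMr ?exprn_ge0 // exprn_ege1 // ler1n.
rewrite -mulr_suml [leRHS]mulrAC -mulrA ler_wpM2r ?mulr_ge0 ?invr_ge0 ?exprn_ge0 ?(ltW r0) //.
exact: aM.
Qed.

End Analysis.

(** * From series to germs *)

Section Link.
Variable K : numFieldType.
Implicit Types (a b : fser K) (m p q : mon3).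

Lemma fps3_mulE a b m : fps3_mul a b m = (a * b) m.
Proof.
transitivity (\sum_(p <- mons (mdeg m).+1 | [forall i, p i <= m i]%N) a p * b (msub m p)).
  transitivity (\sum_(p <- [seq [ffun i => k i : nat] |
      k : {dffun forall i : 'I_3, 'I_(m i).+1}]) a p * b (msub m p)).
    rewrite big_map big_enum /=; apply: eq_bigr => k _; congr (_ * fcoef b _).
    by apply/ffunP => i; rewrite !ffunE.
  rewrite -[RHS]big_filter; apply: perm_big; apply: uniq_perm.
  - rewrite map_inj_uniq ?enum_uniq // => k k' /ffunP h.
    by apply/ffunP => i; apply: val_inj; move: (h i); rewrite !ffunE.
  - exact/filter_uniq/mons_uniq.
  move=> p; rewrite mem_filter mem_mons; apply/mapP/andP => [[k _ ->]|[/forallP h _]].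
    split; first by apply/forallP => i; rewrite ffunE -ltnS.
    by rewrite ltnS /mdeg; apply: leq_sum => i _; rewrite ffunE -ltnS.
  exists [ffun i => Ordinal (h i : (p i < (m i).+1)%N)]; first by rewrite mem_enum.
  by apply/ffunP => i; rewrite !ffunE.
rewrite (@fcoefM _ (mdeg m).+1) // big_mkcond; apply: eq_bigr => p _.
case: ifP => [/forallP h|/forallP h]; last first.
  rewrite big1 // => q /eqP e; case: h => i; by rewrite -e ffunE leq_addr.
have e : m = madd (msub m p) p by apply/ffunP => i; rewrite !ffunE subnK.
rewrite (eq_bigl (pred1 (msub m p))) ?sum_mons1 //.
  by rewrite ltnS {2}e mdegD leq_addr.
by move=> q; rewrite /= {1}e maddC maddIr.
Qed.

End Link.

Section Differential.
Variable K : numFieldType.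
Hypothesis Kc : geom_complete K.
Implicit Types (a b : fser K) (r s t M e : K) (x y v : 'rV[K]_3).

Lemma near0_forall (I : finType) (P : I -> 'rV[K]_3 -> Prop) :
  (forall i, \forall x \near (0 : 'rV[K]_3), P i x) ->
  \forall x \near (0 : 'rV[K]_3), forall i, P i x.
Proof. exact: (@filter_forall _ I P _ (nbhs_filter (0 : 'rV[K]_3))). Qed.

Lemma linear_continuous_bound (W : normedModType K) (L : {linear 'rV[K]_3 -> W}) M :
  (forall v, `|L v| <= M * `|v|) -> continuous L.
Proof.
move=> h; apply: continuousfor0_continuous; rewrite /prop_for /continuous_at linear0.
apply/(@cvgrPdist_lt _ _ _ _ (nbhs_filter (0 : 'rV[K]_3))) => e e0.
have M0 : 0 < `|M| + 1 by rewrite ltr_wpDl.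
change (\forall v \near (0 : 'rV[K]_3), `|0 - L v| < e).
apply/nbhs_norm0P; exists (e / (`|M| + 1)); first by rewrite /= divr_gt0.
move=> v /= hv; rewrite sub0r normrN; apply: le_lt_trans (h v) _.
have M1 : M * `|v| <= (`|M| + 1) * `|v|.
  have [->|v0] := eqVneq v 0; first by rewrite normr0 !mulr0.
  have vp : 0 < `|v| by rewrite normr_gt0.
  have Mr : 0 <= M by rewrite -(pmulr_lge0 _ vp); exact: le_trans (h v).
  by rewrite ler_pM2r // ger0_norm // lerDl.
by apply: le_lt_trans M1 _; rewrite mulrC -ltr_pdivlMr.
Qed.

Lemma diff_of_quadratic (W : normedModType K) (f : 'rV[K]_3 -> W)
   (df : {linear 'rV[K]_3 -> W}) x M : continuous df -> 0 <= M ->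
  (\forall v \near (0 : 'rV[K]_3), `|f (x + v) - f x - df v| <= M * `|v| ^+ 2) ->
  'd f x = df :> ('rV[K]_3 -> W).
Proof.
move=> cdf M0 h; apply: diff_unique => //; apply/eqaddoP => e e0.
have d0 : 0 < e / (M + 1) by rewrite divr_gt0 // ltr_wpDl.
have h' : \forall v \near (0 : 'rV[K]_3), `|v| < e / (M + 1).
  by apply/nbhs_norm0P; exists (e / (M + 1)).
apply: filterS2 h h' => v hv hv'.
rewrite (_ : (f \o shift x - (cst (f x) + df)) v = f (x + v) - f x - df v); last first.
  by rewrite !fctE /= opprD addrA [v + x]addrC.
apply: le_trans hv _; rewrite expr2 mulrA ler_wpM2r //.
apply: le_trans (_ : (M + 1) * `|v| <= _); first by rewrite ler_wpM2r // lerDl.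
by rewrite mulrC -ler_pdivlMr ?ltr_wpDl // ltW.
Qed.

Definition lform (c : 'I_3 -> K) (v : 'rV[K]_3) : K^o := \sum_(i < 3) v 0 i * c i.

Lemma lform_linear c : linear (lform c).
Proof.
move=> k u v; rewrite /lform scaler_sumr -big_split; apply: eq_bigr => i _ /=.
by rewrite !mxE mulrDl /GRing.scale /= mulrA.
Qed.
HB.instance Definition _ c :=
  GRing.isLinear.Build K 'rV[K]_3 K^o *:%R (lform c) (lform_linear c).

Lemma lform_bound c v : `|lform c v| <= (\sum_i `|c i|) * `|v|.
Proof.
apply: le_trans (ler_norm_sum _ _ _) _; rewrite mulr_suml; apply: ler_sum => i _.
by rewrite normrM mulrC ler_wpM2l // coord_le_norm.
Qed.

Lemma lform_delta c i : lform c (delta_mx 0 i) = c i.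
Proof.
rewrite /lform (bigD1 i) //= mxE !eqxx mul1r big1 ?addr0 // => j /negbTE h.
by rewrite mxE h andbF mul0r.
Qed.

Lemma taylor_quadratic f a : taylor_at0 f (fcoef a) ->
  exists2 M, 0 <= M & \forall x \near (0 : 'rV[K]_3), \forall v \near (0 : 'rV[K]_3),
    `|f (x + v) - f x - lform (fun i => feval (fderiv i a) x) v| <= M * `|v| ^+ 2.
Proof.
move=> ta; have [s [M [s0 aM]]] := taylor_fconv ta.
have s40 : 0 < s / 4%:R by rewrite divr_gt0.
have h1 : \forall x \near (0 : 'rV[K]_3), `|x| < s / 4%:R.
  by apply/nbhs_norm0P; exists (s / 4%:R).
have : \forall x \near (0 : 'rV[K]_3), f x = feval a x /\ `|x| < s / 4%:R.
  by apply: filterS2 (taylor_eq_feval Kc ta) h1.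
move=> /nbhs_norm0P[e /= e0 he].
exists (M / (s / 4%:R) ^+ 2).
  by rewrite divr_ge0 ?(bounded_at_ge0 aM) // exprn_ge0 // ltW.
have e2 : 0 < e / 2%:R by rewrite divr_gt0.
have ee : e / 2%:R < e by rewrite ltr_pdivrMr // ltr_pMr // ltr1n.
apply/nbhs_norm0P; exists (e / 2%:R) => // x /= hx.
apply/nbhs_norm0P; exists (e / 2%:R) => // v /= hv.
have [fx xs] := he x (lt_trans hx ee).
have [_ vs] := he v (lt_trans hv ee).
have [fxv _] : f (x + v) = feval a (x + v) /\ `|x + v| < s / 4%:R.
  by apply: he; apply: le_lt_trans (ler_normD _ _) _; rewrite [ltRHS]splitr ltrD.
rewrite fxv fx; apply: (taylor_remainder Kc s0 aM) => [i|i|]; last exact: ltW.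
  exact: le_trans (coord_le_norm x i) (ltW xs).
exact: coord_le_norm.
Qed.

Lemma taylor_diff (f : 'rV[K]_3 -> K^o) a : taylor_at0 f (fcoef a) ->
  \forall x \near (0 : 'rV[K]_3),
    'd f x = lform (fun i => feval (fderiv i a) x) :> ('rV[K]_3 -> K^o).
Proof.
move=> /taylor_quadratic[M M0 h]; apply: filterS h => x hx.
apply: (@diff_of_quadratic _ f _ x M) => //.
exact: linear_continuous_bound (lform_bound _).
Qed.

Lemma feval_at0 a : feval a 0 = a mzero.
Proof.
apply: feval_unique.
apply: (@cvg_half_close _ Kc _ (fun=> a mzero) `|a mzero|); last exact: cvg_cst.
case=> [|n].
  by rewrite /psum big_seq big1 => [|m]; rewrite ?mem_mons // sub0r normrN expr0 invr1 mulr1.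
rewrite /psum (bigID (pred1 mzero)) /= sum_mons1 ?mdeg0 // monx0 mulr1.
rewrite big1 ?addr0 ?subrr ?normr0 ?mulr_ge0 ?invr_ge0 ?exprn_ge0 // => m m0.
have [i mi] : exists i, m i != 0%N.
  apply: contrapT => /forallNP h; case/negP: m0; apply/eqP/ffunP => i.
  by rewrite ffunE; apply/eqP/negPn/negP/h.
by rewrite /monx (bigD1 i) //= mxE expr0n (negbTE mi) mul0r mulr0.
Qed.

Lemma taylor_at_origin f a : taylor_at0 f (fcoef a) -> a mzero = f 0.
Proof. by move=> /(taylor_eq_feval Kc)/nbhs_singleton ->; rewrite feval_at0. Qed.

(** Induction on the degree: the derivatives of the zero germ vanish, and their
    expansions are the derivatives of a. *)
Lemma feval_eq0 a : fconv a ->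
  (\forall x \near (0 : 'rV[K]_3), feval a x = 0) -> a = 0.
Proof.
move=> ca h; apply/fserP => m; rewrite fcoef0; elim/mon_ind: m a ca h => [|m i IH] a ca h.
  by rewrite -feval_at0; exact: nbhs_singleton h.
have t0 : taylor_at0 (cst (0 : K^o)) (fcoef a).
  by apply: filterS2 h (fconv_taylor Kc ca) => x ->.
have /IH : \forall x \near (0 : 'rV[K]_3), feval (fderiv i a) x = 0.
  apply: filterS (taylor_diff t0) => x /(congr1 (fun g => g (delta_mx 0 i))).
  by rewrite diff_cst lform_delta.
move=> /(_ (fconv_deriv i ca)) /eqP; rewrite fderivE mulf_eq0 pnatr_eq0 /=.
by move=> /eqP.
Qed.

Lemma jacobian_taylor (X : 'rV[K]_3 -> 'rV[K]_3) (A : 'I_3 -> fser K) :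
  (forall i, taylor_at0 (fun x => X x 0 i) (fcoef (A i))) ->
  'J X 0 = \matrix_(j, i) A i (munit j).
Proof.
move=> tA; set C := \matrix_(j, i) _.
have hM i : exists M, 0 <= M /\ \forall v \near (0 : 'rV[K]_3),
    `|X (0 + v) 0 i - X 0 0 i - (v *m C) 0 i| <= M * `|v| ^+ 2.
  have [M M0 /nbhs_singleton h] := taylor_quadratic (tA i); exists M; split => //.
  apply: filterS h => v; congr (`|_ - _| <= _).
  rewrite mxE; apply: eq_bigr => j _; congr (_ * _).
  by rewrite feval_at0 fderivE maddC madd0 ffunE mul1r mxE.
have [M hM'] := choice hM.
have M0 i : 0 <= M i by case: (hM' i).
have near_all : \forall v \near (0 : 'rV[K]_3), forall i,
    `|X (0 + v) 0 i - X 0 0 i - (v *m C) 0 i| <= M i * `|v| ^+ 2.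
  by apply: near0_forall => i; case: (hM' i).
have e : 'd X 0 = mulmxr C :> ('rV[K]_3 -> 'rV[K]_3).
  apply: (@diff_of_quadratic _ _ (mulmxr C) _ (\sum_i M i)).
  - apply: (@linear_continuous_bound _ _ (\sum_i \sum_j `|C j i|)) => v /=.
    apply: norm_le_coord => [|i].
      by rewrite mulr_ge0 // sumr_ge0 // => i _; rewrite sumr_ge0.
    rewrite mxE; apply: le_trans (ler_norm_sum _ _ _) _.
    apply: (@le_trans _ _ ((\sum_j `|C j i|) * `|v|)).
      rewrite mulr_suml; apply: ler_sum => j _.
      by rewrite normrM mulrC ler_wpM2l // coord_le_norm.
    rewrite ler_wpM2r // [leRHS](bigD1 i) //= lerDl sumr_ge0 // => j _.
    by rewrite sumr_ge0.
  - by rewrite sumr_ge0.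
  apply: filterS near_all => v hv; apply: norm_le_coord => [|i].
    by rewrite mulr_ge0 ?exprn_ge0 // sumr_ge0.
  rewrite !mxE; apply: le_trans (_ : M i * `|v| ^+ 2 <= _).
    by have := hv i; rewrite !mxE.
  by rewrite ler_wpM2r ?exprn_ge0 // (bigD1 i) //= lerDl sumr_ge0.
apply/matrixP => j i; rewrite /jacobian mxE e /= mxE (bigD1 j) //= mxE !eqxx mul1r.
by rewrite big1 ?addr0 // => k /negbTE h; rewrite mxE h andbF mul0r.
Qed.

Lemma lie_diff (X : 'rV[K]_3 -> 'rV[K]_3) (A : 'I_3 -> fser K) a :
  (forall i, taylor_at0 (fun x => X x 0 i) (fcoef (A i))) -> fconv a -> lie A a = 0 ->
  \forall x \near (0 : 'rV[K]_3), 'd (feval a : 'rV[K]_3 -> K^o) x (X x) = 0.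
Proof.
move=> tA ca la; have cA i : fconv (A i) := taylor_fconv (tA i).
have cd i := fconv_deriv i ca.
have h1 : \forall x \near (0 : 'rV[K]_3), forall i, X x 0 i = feval (A i) x.
  by apply: near0_forall => i; exact: taylor_eq_feval.
have h2 : \forall x \near (0 : 'rV[K]_3), forall i,
    feval (A i * fderiv i a) x = feval (A i) x * feval (fderiv i a) x.
  by apply: near0_forall => i; exact: fevalM.
have h3 := feval_sum Kc (fun i => fconvM (cA i) (cd i)).
have h4 := taylor_diff (fconv_taylor Kc ca : taylor_at0 (feval a : _ -> K^o) a).
have h12 : \forall x \near (0 : 'rV[K]_3),
    \sum_i X x 0 i * feval (fderiv i a) x = \sum_i feval (A i * fderiv i a) x.
  by apply: filterS2 h1 h2 => x e1 e2; apply: eq_bigr => i _; rewrite e1 e2.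
apply: filterS3 h12 h3 h4 => x e12 e3 ->.
by rewrite /lform e12 -e3 -[\sum_i _]/(lie A a) la feval0.
Qed.

Lemma wedge_diff_neq0 a b : fconv a -> fconv b ->
  (exists i j, fwedge a b i j != 0) ->
  ~ (\forall x \near (0 : 'rV[K]_3), forall u v,
       wedge_d (feval a) (feval b) x u v = 0).
Proof.
move=> ca cb [i [j /eqP w0]] h; apply: w0.
have da k := fconv_deriv k ca; have db k := fconv_deriv k cb.
apply: feval_eq0; first by apply: fconvD; [|apply: fconvN]; exact: fconvM.
have h1 := taylor_diff (fconv_taylor Kc ca : taylor_at0 (feval a : _ -> K^o) a).
have h2 := taylor_diff (fconv_taylor Kc cb : taylor_at0 (feval b : _ -> K^o) b).
have h3 : \forall x \near (0 : 'rV[K]_3),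
   feval (fderiv i a) x * feval (fderiv j b) x - feval (fderiv j a) x * feval (fderiv i b) x = 0.
  apply: filterS3 h h1 h2 => x hw e1 e2.
  have d1 k : 'd (feval a : 'rV[K]_3 -> K^o) x (delta_mx 0 k) = feval (fderiv k a) x.
    by rewrite e1 lform_delta.
  have d2 k : 'd (feval b : 'rV[K]_3 -> K^o) x (delta_mx 0 k) = feval (fderiv k b) x.
    by rewrite e2 lform_delta.
  apply: etrans (hw (delta_mx 0 i) (delta_mx 0 j)).
  by congr (_ * _ - _ * _); apply/esym; [exact: d1|exact: d2|exact: d1|exact: d2].
have h4 := fevalM Kc (da i) (db j); have h5 := fevalM Kc (da j) (db i).
have h6 : \forall x \near (0 : 'rV[K]_3),
   feval (fderiv i a * fderiv j b) x - feval (fderiv j a * fderiv i b) x = 0.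
  by apply: filterS3 h3 h4 h5 => x + e1 e2; rewrite e1 e2.
have h7 := fevalD Kc (fconvM (da i) (db j)) (fconvN (fconvM (da j) (db i))).
have h8 := fevalN Kc (fconvM (da j) (db i)).
by apply: filterS3 h6 h7 h8 => x + e1 e2; rewrite e1 e2.
Qed.

End Differential.

(** * Completeness of the complex numbers *)

Lemma real_geom_cvg (R : realType) (w : nat -> R) (M : R) :
  (forall n, `|w n.+1 - w n| <= M * 2%:R ^- n) -> exists l : R, w @ \oo --> l.
Proof.
move=> h; have M0 : 0 <= M.
  by have := le_trans (normr_ge0 _) (h 0%N); rewrite expr0 invr1 mulr1.
have hc : cvgn (series (fun n => w n.+1 - w n)).
  apply: (@normed_cvg R R^o); apply: (@series_le_cvg R _ (geometric M 2%:R^-1)).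
  - by move=> n /=.
  - by move=> n /=; rewrite mulr_ge0 // exprn_ge0 // invr_ge0.
  - by move=> n /=; rewrite exprVn.
  by apply: is_cvg_geometric_series; rewrite ger0_norm ?invr_ge0 // invf_lt1 // ltr1n.
pose S := series (fun n => w n.+1 - w n).
have e : w = S \+ cst (w 0%N).
  by apply: funext => n; rewrite /S /series /= telescope_sumr // subrK.
exists (lim (S @ \oo) + w 0%N); rewrite [X in X @ _]e.
by apply: (@cvgD _ R^o) => //; exact: cvg_cst.
Qed.

Lemma normc_ge_Im (R : realType) (z : R[i]) : (`|complex.Im z|%:C)%C <= `|z|.
Proof.
by rewrite normc_def lecR -sqrtr_sqr ler_sqrt ?lerDr ?sqr_ge0 // addr_ge0 ?sqr_ge0.
Qed.

Lemma normc_le_ReIm (R : realType) (z : R[i]) :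
  `|z| <= ((`|complex.Re z| + `|complex.Im z|)%:C)%C.
Proof.
have h : 0 <= `|complex.Re z| + `|complex.Im z| by rewrite addr_ge0.
rewrite normc_def lecR -[leRHS](ger0_norm h) -sqrtr_sqr ler_sqrt ?sqr_ge0 //.
by rewrite sqrrD !real_normK ?num_real // addrAC lerDl mulrn_wge0 // mulr_ge0.
Qed.

Lemma complex_geom_complete (R : realType) : geom_complete R[i].
Proof.
have pow2 n : (2%:R ^- n : R[i]) = ((2%:R ^- n : R)%:C)%C.
  by rewrite fmorphV rmorphXn rmorph_nat.
have pos (e : R[i]) : 0 < e -> exists2 e' : R, 0 < e' & e = (e'%:C)%C.
  case: e => a b; rewrite ltcE /= => /andP[/eqP -> a0]; by exists a.
split=> [_ /pos[e e0 ->]|u M h].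
  have [N hN] : exists N : nat, e^-1 < N%:R.
    by exists (Num.trunc e^-1).+1; exact: truncnS_gt.
  exists N; rewrite pow2 ltcR -[ltRHS]invrK ltf_pV2 ?posrE ?exprn_gt0 ?invr_gt0 //.
  apply: lt_trans hN _; rewrite -natrX ltr_nat; exact: ltn_expl.
have M0 : 0 <= M.
  by have := le_trans (normr_ge0 _) (h 0%N); rewrite expr0 invr1 mulr1.
have [m Mm] : exists m : R, M = (m%:C)%C.
  by apply/complex_realP; rewrite realE M0.
have [a ha] : exists a : R, (fun n => complex.Re (u n)) @ \oo --> a.
  apply: (@real_geom_cvg _ _ m) => n; rewrite -lecR rmorphM /= -pow2 -Mm.
  apply: le_trans (h n); apply: le_trans (normc_ge_Re _).
  by rewrite raddfB.
have [b hb] : exists b : R, (fun n => complex.Im (u n)) @ \oo --> b.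
  apply: (@real_geom_cvg _ _ m) => n; rewrite -lecR rmorphM /= -pow2 -Mm.
  apply: le_trans (h n); apply: le_trans (normc_ge_Im _).
  by rewrite raddfB.
exists (Complex a b); apply/cvgrPdist_lt => _ /pos[e e0 ->].
have e2 : 0 < e / 2%:R by rewrite divr_gt0.
move/cvgrPdist_lt/(_ _ e2): ha => ha; move/cvgrPdist_lt/(_ _ e2): hb => hb.
apply: filterS2 ha hb => n h1 h2; apply: le_lt_trans (normc_le_ReIm _) _.
by rewrite ltcR [ltRHS]splitr; apply: ltrD; rewrite raddfB.
Qed.

(** * Convergent first integrals *)

Section ConvergentIntegrals.
Variable K : numFieldType.
Implicit Types (a b f : fser K) (m p q : mon3) (X A : 'I_3 -> fser K).

Definition indep_integrals X f1 f2 :=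
  [/\ lie X f1 = 0, lie X f2 = 0 & exists i j, fwedge f1 f2 i j != 0].

Lemma indep_integrals_related X Y Phi Psi f1 f2 :
  (forall i, ord_ge 1 (Phi i)) -> (forall i, ord_ge 1 (Psi i)) ->
  (forall i, fcomp (Phi i) Psi = fX K i) -> frelated Y X Phi ->
  indep_integrals X f1 f2 -> indep_integrals Y (fcomp f1 Phi) (fcomp f2 Phi).
Proof.
move=> h1 h2 e rel [e1 e2 w]; split; last exact: (fwedge_comp_neq0 h1 h2 e w).
  by rewrite (lie_related _ h1 rel) e1 fcomp0.
by rewrite (lie_related _ h1 rel) e2 fcomp0.
Qed.

Lemma indep_mon_deg p q : indep_mon p q -> (0 < mdeg p)%N /\ (0 < mdeg q)%N.
Proof.
by move=> [i [j ne]]; split; rewrite lt0n mdeg_eq0; apply/eqP => e; apply: ne;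
  rewrite e !ffunE ?muln0.
Qed.

(** The first integrals are the resonant monomials x^p and x^q in the
    linearizing coordinates. *)
Lemma diagonal_convergent_integrals (lam : 'I_3 -> K) (h : 'I_3 -> fser K) F1 F2 :
  (forall i, lam i != 0) -> (forall i, ord_ge 2 (h i)) -> (forall i, fconv (h i)) ->
  indep_integrals (addvf (diag_vf lam) h) F1 F2 ->
  exists f1 f2, [/\ fconv f1, fconv f2, ord_ge 1 f1 /\ ord_ge 1 f2 &
    indep_integrals (addvf (diag_vf lam) h) f1 f2].
Proof.
move=> lam0 h2 ch [e1 e2 w].
have [phi [g [p [q [[p2 g1] [wp wq pq] rel [C C0 est]]]]]] :=
  formal_linearization lam0 h2 e1 e2 w.
have [psi [s2 se ps sp]] := near_id_inverse p2.
have s1 := near_id1 s2; have p1 := near_id1 p2.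
have cphi := fconv_linearization p2 g1 h2 ch C0 est.
have cpsi := fconv_inverse p2 s2 se cphi.
have cn i : fconv (near_id psi i) by apply: fconvD => //; exact: fconv_mon.
have [dp dq] := indep_mon_deg pq.
have rel' := frelated_inv p1 s1 sp ps rel.
exists (fcomp (fmon K p) (near_id psi)), (fcomp (fmon K q) (near_id psi)); split.
- by apply: fconv_comp => //; exact: fconv_mon.
- by apply: fconv_comp => //; exact: fconv_mon.
- by split; apply: ord_ge_comp; apply: ord_geW (@ord_ge_mon K _).
apply: (indep_integrals_related s1 p1 sp rel'); split; last exact: wedge_mon_neq0.
  exact: resonant_monomial_integral.
exact: resonant_monomial_integral.
Qed.

(** The substitution x |-> x P on row vectors. *)
Definition linmap (P : 'M[K]_3) : 'I_3 -> fser K :=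
  fun i => \sum_k fconst (P k i) * fX K k.

Lemma linmap1 P i : ord_ge 1 (linmap P i).
Proof. by apply: ord_ge_sum => k _; apply/ord_geMr/ord_geX. Qed.

Lemma fconv_linmap P i : fconv (linmap P i).
Proof.
by apply: fconv_sum => k _; apply: fconvM; [exact: fconv_const | exact: fconv_mon].
Qed.

Lemma linmap_comp P Q i : fcomp (linmap P i) (linmap Q) = linmap (Q *m P) i.
Proof.
rewrite {1}/linmap fcomp_sum.
under eq_bigr => k _ do rewrite (fcompM (linmap1 Q)) (fcomp_const (linmap1 Q))
  (fcompX (linmap1 Q)) /linmap mulr_sumr.
rewrite exchange_big; apply: eq_bigr => l _ /=; rewrite mxE rmorph_sum mulr_suml.
by apply: eq_bigr => k _; rewrite mulrA -rmorphM /= mulrC [Q l k * _]mulrC mulrC.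
Qed.

Lemma linmap_id i : linmap 1%:M i = fX K i.
Proof.
rewrite /linmap (bigD1 i) //= mxE eqxx fconst1 mul1r big1 ?addr0 // => k /negbTE h.
by rewrite mxE h rmorph0 mul0r.
Qed.

Lemma linear_part a : ord_ge 1 a ->
  ord_ge 2 (a - \sum_i fconst (a (munit i)) * fX K i).
Proof.
move=> a1 m hm; rewrite fcoefB fcoef_sum; under eq_bigr do rewrite fcoefCM /=.
have [/eqP|m0] := posnP (mdeg m).
  rewrite mdeg_eq0 => /eqP ->; rewrite a1 ?mdeg0 // big1 ?subrr // => i _.
  by case: eqP => [/(congr1 mdeg)|_]; rewrite ?mdeg0 ?mdeg_unit ?mulr0.
have [i e] : exists i, m = munit i.
  have [i mi] : exists i, m i != 0%N.
    apply: contrapT => /forallNP h; move: m0; rewrite lt0n mdeg_eq0 => /eqP; apply.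
    by apply/ffunP => i; rewrite ffunE; apply/eqP/negPn/negP/h.
  have e : m = madd (msub m (munit i)) (munit i).
    by apply/ffunP => j; rewrite !ffunE subnK //; case: eqP => // ->; rewrite lt0n.
  exists i; rewrite e; have : mdeg (msub m (munit i)) = 0%N.
    by move: hm; rewrite {1}e mdegD mdeg_unit; lia.
  by move/eqP; rewrite mdeg_eq0 => /eqP ->; rewrite maddC madd0.
rewrite e (bigD1 i) //= eqxx mulr1 big1 ?addr0 ?subrr // => j /negbTE ji.
case: eqP => [/ffunP /(_ j)|_]; last by rewrite mulr0.
by rewrite !ffunE eqxx ji.
Qed.

(** The new coordinates w are given by x = w P, where the rows of P are
    eigenvectors of J; the field becomes X_k = sum_i (A_i o P) (P^-1)_ik, with
    linear part P J P^-1. *)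
Lemma convergent_integrals A F1 F2 (J := \matrix_(j, i) A i (munit j) : 'M[K]_3) :
  (forall i, ord_ge 1 (A i)) -> (forall i, fconv (A i)) ->
  J \in unitmx -> diagonalizable J -> indep_integrals A F1 F2 ->
  exists f1 f2, [/\ fconv f1, fconv f2, ord_ge 1 f1 /\ ord_ge 1 f2 & indep_integrals A f1 f2].
Proof.
move=> A1 cA uJ [P uP]; rewrite /similar_to => /is_diag_mxP; set D := conjmx P J => dD int.
pose Q := invmx P.
have DE : D = P *m J *m Q by rewrite /D conjumx.
have QP i : fcomp (linmap P i) (linmap Q) = fX K i.
  by rewrite linmap_comp mulVmx // linmap_id.
have PQ i : fcomp (linmap Q i) (linmap P) = fX K i.
  by rewrite linmap_comp mulmxV // linmap_id.
pose X k := \sum_i fcomp (A i) (linmap P) * fconst (Q i k).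
have rel : frelated X A (linmap P).
  move=> i; rewrite /lie; under eq_bigr => k _.
    rewrite /linmap raddf_sum /= (bigD1 k) //= big1 => [|l /negbTE lk]; last first.
      by rewrite fderivM fderiv_const mul0r add0r fderivX eq_sym lk mulr0.
    rewrite addr0 fderivM fderiv_const mul0r add0r fderivX eqxx mulr1 mulr_suml.
    over.
  rewrite exchange_big (bigD1 i) //= [X in _ + X]big1 ?addr0 => [|l /negbTE li].
    under eq_bigr do rewrite -mulrA -rmorphM; rewrite -mulr_sumr -rmorph_sum /=.
    have := mulmxV uP; rewrite -/Q.
    have /matrixP/(_ i i) : Q *m P = 1%:M by rewrite mulVmx.
    by rewrite !mxE eqxx => -> _; rewrite fconst1 mulr1.
  under eq_bigr do rewrite -mulrA -rmorphM; rewrite -mulr_sumr -rmorph_sum /=.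
  have /matrixP/(_ l i) : Q *m P = 1%:M by rewrite mulVmx.
  by rewrite !mxE li => ->; rewrite rmorph0 mulr0.
pose lam k := D k k.
pose h k := X k - fconst (lam k) * fX K k.
have XE : X = addvf (diag_vf lam) h.
  by apply: funext => k; rewrite /addvf /diag_vf /h addrC subrK.
have lam0 k : lam k != 0.
  have uD : D \in unitmx by rewrite DE !unitmx_mul uP uJ unitmx_inv.
  apply: contraTneq uD => l0; have e : delta_mx 0 k *m D = 0 :> 'rV_3.
    apply/rowP => j; rewrite -rowE [LHS]mxE [RHS]mxE; have [<-|kj] := eqVneq k j.
      exact: l0.
    by apply: dD; rewrite val_eqE.
  apply/negP => uD; have : delta_mx 0 k = 0 :> 'rV[K]_3.
    by rewrite -[LHS](mulmxK uD) e mul0mx.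
  by move/rowP/(_ k)/eqP; rewrite !mxE !eqxx oner_eq0.
have h2 k : ord_ge 2 (h k).
  have lin i : ord_ge 2 (fcomp (A i) (linmap P) - linmap (P *m J) i).
    have := ord_ge_comp (linmap P) (linear_part (A1 i)).
    rewrite (_ : fcomp (_ - _) _ = fcomp (A i) (linmap P) - linmap (P *m J) i) //.
    have -> : \sum_j fconst (A i (munit j)) * fX K j = linmap J i.
      by apply: eq_bigr => j _; rewrite mxE.
    rewrite -linmap_comp -[LHS]addr0 -(subrr (fcomp (linmap J i) (linmap P))) addrA.
    by rewrite -fcompD subrK.
  have -> : h k = \sum_i (fcomp (A i) (linmap P) - linmap (P *m J) i) * fconst (Q i k).
    under [RHS]eq_bigr do rewrite mulrBl; rewrite sumrB; congr (_ - _).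
    transitivity (linmap D k).
      rewrite /linmap (bigD1 k) //= big1 ?addr0 // => j /eqP jk.
      by rewrite dD ?rmorph0 ?mul0r // val_eqE; apply/eqP.
    rewrite DE; under [RHS]eq_bigr do rewrite mulr_suml.
    rewrite exchange_big; apply: eq_bigr => j _ /=; rewrite mxE rmorph_sum mulr_suml.
    by apply: eq_bigr => l _; rewrite rmorphM /=; ring.
  by apply: ord_ge_sum => i _; exact: ord_geMl.
have ch k : fconv (h k).
  apply: fconvD; last by apply/fconvN/fconvM; [exact: fconv_const|exact: fconv_mon].
  apply: fconv_sum => i _; apply: fconvM; last exact: fconv_const.
  by apply: fconv_comp => // j; [exact: fconv_linmap | exact: linmap1].
have int' : indep_integrals (addvf (diag_vf lam) h) (fcomp F1 (linmap P)) (fcomp F2 (linmap P)).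
  by rewrite -XE; apply: (indep_integrals_related (@linmap1 P) (@linmap1 Q) QP rel).
have [f1 [f2 [c1 c2 [z1 z2]]]] := diagonal_convergent_integrals lam0 h2 ch int'.
rewrite -XE => fint.
have rel' := frelated_inv (@linmap1 P) (@linmap1 Q) PQ QP rel.
exists (fcomp f1 (linmap Q)), (fcomp f2 (linmap Q)); split.
- by apply: fconv_comp => // i; [exact: fconv_linmap | exact: linmap1].
- by apply: fconv_comp => // i; [exact: fconv_linmap | exact: linmap1].
- by split; apply: ord_ge_comp.
exact: (indep_integrals_related (@linmap1 Q) (@linmap1 P) PQ rel').
Qed.

End ConvergentIntegrals.

Lemma formal_first_integral_series (K : numFieldType) (X : 'rV[K]_3 -> 'rV[K]_3)
    (f1 f2 : fps3 K) :
  formal_first_integral X f1 f2 ->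
  exists2 A : 'I_3 -> fser K, forall i, taylor_at0 (fun x => X x 0 i) (fcoef (A i)) &
    indep_integrals A (Fser f1) (Fser f2).
Proof.
case=> w [A [tA l1 l2]]; exists (fun i => Fser (A i)) => //; split.
- apply/fserP => m; rewrite /lie fcoef_sum fcoef0 -[RHS](l1 m) /fps3_lie; apply: eq_bigr => i _.
  by rewrite -fps3_mulE.
- apply/fserP => m; rewrite /lie fcoef_sum fcoef0 -[RHS](l2 m) /fps3_lie; apply: eq_bigr => i _.
  by rewrite -fps3_mulE.
apply: contrapT => /forallNP h; apply: w => i j m.
have /fserP/(_ m) : fwedge (Fser f1) (Fser f2) i j = 0.
  by apply/eqP/negPn/negP => ne; apply: (h i); exists j.
by rewrite /fwedge fcoefB fcoef0 /fps3_wedge -!fps3_mulE.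
Qed.

Theorem theorem3p3p1 (R : realType) (X : 'rV[R[i]]_3 -> 'rV[R[i]]_3)
    (hX : gen_vector_field X)
    (hformal : exists fh1 fh2 : fps3 R[i], formal_first_integral X fh1 fh2) :
  exists f1 f2 : 'rV[R[i]]_3 -> R[i], holo_first_integral X f1 f2.
Proof.
have Kc := complex_geom_complete R.
case: hX => -[_ X0] uJ dJ _; case: hformal => fh1 [fh2 /formal_first_integral_series[A tA int]].
have cA i : fconv (A i) := taylor_fconv (tA i).
have A1 i : ord_ge 1 (A i).
  move=> m; rewrite ltnS leqn0 mdeg_eq0 => /eqP ->.
  by rewrite (taylor_at_origin Kc (tA i)) X0 mxE.
have JE := jacobian_taylor Kc tA; rewrite JE in uJ dJ.
have [f1 [f2 [c1 c2 [z1 z2] [l1 l2 w]]]] := convergent_integrals A1 cA uJ dJ int.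
exists (feval f1), (feval f2); split.
- by split; [exists (fcoef f1) | exists (fcoef f2)]; exact: fconv_taylor.
- by rewrite !feval_at0 // z1 ?z2 ?mdeg0.
- exact: wedge_diff_neq0.
- exact: lie_diff tA c1 l1.
- exact: lie_diff tA c2 l2.
Qed.
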